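(* Let $X$ be a connected locally finite hyperbolic graph, let $G\leq\mathrm{Aut}(X)$ be countable, and let $(T,\beta)$ be a $G$-invariant tree-decomposition of $X$ satisfying: (1) every bag $\beta(t)$ induces a connected subgraph $X_t$ of $X$; (2) $(T,\beta)$ has finite adhesion; (3) $G\backslash E(T)$ is finite. For $t\in V(T)$ put $G_t:=\mathrm{Stab}_G(t)$. Then: (a) If $E_G^{\partial T}$ and every $E_{G_t}^{\partial X_t}$ ($t\in V(T)$) are Borel hyperfinite, then $E_G^{\partial X}$ is Borel hyperfinite. (b) If $E_G^{\partial X}$ is Borel hyperfinite, then $E_{G_t}^{\partial X_t}$ is Borel hyperfinite for every $t\in V(T)$. (c) If in addition $(T,\beta)$ is end-essential, then $E_G^{\partial X}$ is Borel hyperfinite if and only if $E_G^{\partial T}$ is Borel hyperfinite and $E_{G_t}^{\partial X_t}$ is Borel hyperfinite for every $t\in V(T)$.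
   Context: Graphs are simple and carry their path metrics; ''hyperbolic'' means Gromov hyperbolic. $\partial X$ is the Gromov boundary of $X$: equivalence classes of geodesic rays, two rays being equivalent if they have finite Hausdorff distance, with the usual topology. A ray is a one-way infinite simple path; two rays are equivalent if, after deleting any finite vertex set, they have tails in the same component; an end is an equivalence class of rays. For a tree $T$, $\partial T$ is its set of ends with the end topology (basic open sets: the ends all of whose rays have tails in $C$, for $C$ a component of $T$ minus a finite vertex set); it is standard Borel when $T$ is countable. A tree-decomposition of a graph $X$ is a pair $(T,\beta)$ with $T$ a tree and $\beta:V(T)\to\mathcal P(V(X))$ such that: (1) $V(X)=\bigcup_{t}\beta(t)$; (2) every edge of $X$ has both endpoints in some bag $\beta(t)$; (3) for every $x\in V(X)$ the set $\{t\in V(T):x\in\beta(t)\}$ is a connected subtree of $T$. The adhesion set of $e=uv\in E(T)$ is $S_e=\beta(u)\cap\beta(v)$; finite adhesion means every $S_e$ is finite. For $G\le\mathrm{Aut}(X)$, $(T,\beta)$ is $G$-invariant if $G$ acts on $T$ by tree automorphisms and $\beta(gt)=g\beta(t)$ for all $g\in G$, $t\in V(T)$. $X_t=X[\beta(t)]$ is the induced subgraph; $G_t$ acts on it. For $e=uv\in E(T)$, let $T_u^e,T_v^e$ be the components of $T-e$ containing $u,v$ respectively, and $V_u^e:=\bigcup_{s\in V(T_u^e)}\beta(s)$, $V_v^e:=\bigcup_{s\in V(T_v^e)}\beta(s)$. A finite-adhesion tree-decomposition is end-essential if for every $e=uv\in E(T)$ each of the two sides $V_u^e$, $V_v^e$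 contains a tail of every ray in some end of $X$ (the end depending on the side). For a countable group $H$ acting by Borel automorphisms on a standard Borel space $Y$, $E_H^Y$ is the orbit equivalence relation. A countable Borel equivalence relation is Borel hyperfinite if it is an increasing union of a sequence of finite Borel equivalence relations (Borel equivalence relations all of whose classes are finite). *)

(* Defs.v *)
From HB Require Import structures.
From mathcomp Require Import all_boot all_order all_algebra.
From mathcomp Require Import all_classical topology measure.

Set Implicit Arguments.
Unset Strict Implicit.
Unset Printing Implicit Defensive.

Import Order.TTheory GRing.Theory Num.Theory.
Local Open Scope classical_set_scope.

(* Classically every type carries a choiceType structure, so this covers simple
   graphs of arbitrary cardinality. *)
Record graph := Graph {
  vertex :> choiceType;
  adj : rel vertex;
  adj_sym : symmetric adj;
  adj_irrefl : irreflexive adj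
}.

Section Graphs.
Variable X : graph.
Implicit Types (x y : X) (S A : set X) (r : nat -> X).

Definition has_walk x y (n : nat) : Prop :=
  exists p : seq X, [/\ path (@adj X) x p, last x p = y & size p = n].

Definition reachable x y : Prop := exists n, has_walk x y n.

Definition graph_connected : Prop := forall x y, reachable x y.

Definition locally_finite : Prop := forall x, finite_set [set y | adj x y].

Definition is_tree : Prop :=
  graph_connected /\
  forall c : seq X, (2 < size c)%N -> ~ (cycle (@adj X) c /\ uniq c).

(* Junk value 0 when x and y lie in different components. *)
Definition dist x y : nat :=
  if pselect (exists n, `[< has_walk x y n >]) is left e then ex_minn e else 0.

Definition gromov_product (w x y : X) : rat :=
  (((dist x w)%:R + (dist y w)%:R - (dist x y)%:R) / 2)%R.

Definition hyperbolic : Prop := exists delta : rat, forall w x y z : X,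
  (Num.min (gromov_product w x y) (gromov_product w y z) - delta
     <= gromov_product w x z)%R.

End Graphs.

Arguments dist {X}.

Section Subgraphs.
Variable X : graph.
Implicit Types (x y : X) (S A : set X) (r : nat -> X).

Definition induced_adj A : rel A := fun a b => @adj X (val a) (val b).

Lemma induced_adj_sym A : symmetric (@induced_adj A).
Proof. by move=> a b; exact: adj_sym. Qed.

Lemma induced_adj_irrefl A : irreflexive (@induced_adj A).
Proof. by move=> a; exact: adj_irrefl. Qed.

Definition induced A : graph :=
  Graph (@induced_adj_sym A) (@induced_adj_irrefl A).

Definition incl A (a : induced A) : X := val (a : set_type A).

Definition edge_deleted_adj (u v : X) : rel X := fun x y =>
  adj x y && ~~ (((x == u) && (y == v)) || ((x == v) && (y == u))).

Lemma edge_deleted_adj_sym u v : symmetric (edge_deleted_adj u v).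
Proof.
move=> x y; rewrite /edge_deleted_adj adj_sym; congr (_ && ~~ _).
by rewrite orbC; congr (_ || _); rewrite andbC.
Qed.

Lemma edge_deleted_adj_irrefl u v : irreflexive (edge_deleted_adj u v).
Proof. by move=> x; rewrite /edge_deleted_adj adj_irrefl. Qed.

Definition edge_deleted (u v : X) : graph :=
  Graph (edge_deleted_adj_sym u v) (edge_deleted_adj_irrefl u v).

(* The vertex sets, as subsets of X, of the components of X - S. *)
Definition components_minus S : set (set X) :=
  [set @incl (~` S) @` [set b | reachable a b] | a in [set: induced (~` S)]].

Definition ray : set (nat -> X) :=
  [set r | injective r /\ forall i, adj (r i) (r i.+1)].

Definition has_tail_in A r : Prop :=
  exists n, forall i, (n <= i)%N -> A (r i).

Definition end_equiv (r s : nat -> X) : Prop :=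
  forall S, finite_set S ->
  exists C, [/\ components_minus S C, has_tail_in C r & has_tail_in C s].

Definition ends : set (set (nat -> X)) :=
  [set [set s | ray s /\ end_equiv r s] | r in ray].

Definition geodesic_ray : set (nat -> X) :=
  [set r | forall i j, (i <= j)%N -> dist (r i) (r j) = (j - i)%N].

Definition finite_hausdorff_distance (r s : nat -> X) : Prop :=
  exists K : nat, (forall i, exists j, (dist (r i) (s j) <= K)%N) /\
                  (forall j, exists i, (dist (r i) (s j) <= K)%N).

Definition boundary_points : set (set (nat -> X)) :=
  [set [set s | geodesic_ray s /\ finite_hausdorff_distance r s]
     | r in geodesic_ray].

End Subgraphs.

Arguments incl {X A}.

Definition gromov_boundary (X : graph) : Type := set_type (@boundary_points X).
HB.instance Definition _ (X : graph) := Choice.on (gromov_boundary X).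

(* The quotient of the topology of uniform convergence on bounded sets
   (the compact-open topology) on geodesic rays: A is open when the set of
   geodesic rays r with [r] in A is open.  Vertices being discrete, a basic
   neighbourhood of r is the set of geodesic rays agreeing with r up to time n.
   No base point is fixed; for a connected locally finite hyperbolic graph the
   quotient of the space of rays issuing from any one vertex is the same. *)
Definition boundary_open (X : graph) : set (set (gromov_boundary X)) :=
  [set A | forall xi r, A xi -> val xi r ->
    exists n, forall eta s, val eta s ->
      (forall i, (i <= n)%N -> s i = r i) -> A eta].

Lemma boundary_openT (X : graph) : @boundary_open X setT.
Proof. by move=> xi r _ _; exists 0%N. Qed.

Lemma boundary_openI (X : graph) : setI_closed (@boundary_open X).
Proof.
move=> A B oA oB xi r [Axi Bxi] xir.
have [m Am] := oA _ _ Axi xir; have [n Bn] := oB _ _ Bxi xir.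
exists (maxn m n) => eta s etas rs; split.
- by apply: (Am eta s etas) => i im; apply: rs; rewrite leq_max im.
- by apply: (Bn eta s etas) => i i_n; apply: rs; rewrite leq_max i_n orbT.
Qed.

Lemma boundary_open_bigU (X : graph) (I : Type)
    (f : I -> set (gromov_boundary X)) :
  (forall i, boundary_open (f i)) -> boundary_open (\bigcup_i f i).
Proof.
move=> of_ xi r [i _ fi] xir; have [n fn] := of_ i _ _ fi xir.
by exists n => eta s etas rs; exists i => //; exact: (fn eta s).
Qed.

HB.instance Definition _ (X : graph) :=
  isOpenTopological.Build (gromov_boundary X) (@boundary_openT X)
    (@boundary_openI X) (@boundary_open_bigU X).

Definition end_space (X : graph) : Type := set_type (@ends X).
HB.instance Definition _ (X : graph) := Choice.on (end_space X).

Definition end_basic (X : graph) : set (set (end_space X)) :=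
  [set U | exists S C, [/\ finite_set S, @components_minus X S C &
    U = [set eps | forall r, val eps r -> has_tail_in C r]]].

Definition end_open (X : graph) : set (set (end_space X)) :=
  [set A | forall eps, A eps ->
    exists U, [/\ end_basic U, U eps & U `<=` A]].

Lemma sub_component (X : graph) (S S' C C' : set X) (x : X) :
  S `<=` S' -> components_minus S C -> components_minus S' C' ->
  C x -> C' x -> C' `<=` C.
Proof.
move=> SS' [a _ <-] [a' _ <-] [b [n ab] bx] [b' a'b' b'x].
have sub z : z \in ~` S' -> z \in ~` S.
  by rewrite !inE => nz Sz; apply: nz; exact: SS'.
pose w (c : induced (~` S')) : induced (~` S) :=
  exist _ (incl c) (sub _ (valP (c : set_type (~` S')))).
have walkw c d m : has_walk c d m -> has_walk (w c) (w d) m.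
  move=> [p [cp <- <-]]; exists (map w p); split; last by rewrite size_map.
  - by elim: p c cp => //= e p IH c /andP[ce ep]; apply/andP; split=> //; exact: IH.
  - by rewrite last_map.
have rtrans (Y : graph) (c d e : Y) : reachable c d -> reachable d e -> reachable c e.
  move=> [k [p [cp dp _]]] [l [q [dq eq_ _]]]; exists (size (p ++ q)), (p ++ q).
  by rewrite cat_path last_cat cp dp dq.
have rsym (Y : graph) (c d : Y) : reachable c d -> reachable d c.
  move=> [k [p [cp <- _]]]; exists (size (rev (belast c p))), (rev (belast c p)).
  split=> //; first by rewrite rev_path (eq_path (e' := @adj Y)) // => ? ?; exact: adj_sym.
  by case: p cp => //= e p _; rewrite rev_cons last_rcons.
have wb' : w b' = b by apply: val_inj; rewrite /= b'x -bx.
move=> _ [d a'd <-]; exists (w d) => //=.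
apply: (rtrans _ _ b); first by exists n.
have [m /walkw] := rtrans _ _ _ _ (rsym _ _ _ a'b') a'd.
by rewrite wb' => ?; exists m.
Qed.

Lemma has_tail_in_meet (X : graph) (A B : set X) (r : nat -> X) :
  has_tail_in A r -> has_tail_in B r -> exists x, A x /\ B x.
Proof.
move=> [m Am] [n Bn]; exists (r (maxn m n)).
by split; [apply: Am; exact: leq_maxl|apply: Bn; exact: leq_maxr].
Qed.

Lemma ray_end_equiv (X : graph) (r : nat -> X) : ray r -> end_equiv r r.
Proof.
move=> [inj adjr] S fS.
have [n nS] : exists n, forall i, (n <= i)%N -> ~ S (r i).
  have fP : finite_set (r @^-1` S) by apply: finite_preimage => //; move=> i j _ _; exact: inj.
  have [n hn] : exists n, forall i, S (r i) -> (i < n)%N.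
    have /finite_seqP [s Es] := fP.
    exists (\max_(i <- s) i).+1 => i Si.
    have : i \in s by have : [set` s] i by rewrite -Es.
    by rewrite ltnS => is_; apply: leq_bigmax_seq.
  by exists n => i ni Si; have := hn i Si; rewrite ltnNge ni.
have mem i : (n <= i)%N -> r i \in ~` S by move=> h; rewrite inE; exact: nS.
pose a : induced (~` S) := exist _ (r n) (mem n (leqnn n)).
have reach k : exists2 b, reachable a b & incl b = r (n + k)%N.
  elim: k => [|k [b [m [p [pp lp sp]]] bE]].
    by exists a; [exists 0%N, [::]|rewrite addn0].
  pose c : induced (~` S) := exist _ (r (n + k.+1)%N) (mem _ (leq_addr _ _)).
  exists c => //; exists (size (rcons p c)), (rcons p c).
  split; rewrite ?last_rcons // rcons_path pp lp /= /induced_adj.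
  by rewrite -[val b]/(incl b) bE /= addnS; exact: adjr.
have H : has_tail_in (incl @` [set b | reachable a b]) r.
  exists n => i ni; have [b ab bE] := reach (i - n)%N.
  by exists b => //; rewrite bE subnKC.
by exists (incl @` [set b | reachable a b]); split=> //; exists a.
Qed.

Lemma end_component (X : graph) (eps : end_space X) (S : set X) :
  finite_set S -> exists C,
    components_minus S C /\ forall r, val eps r -> has_tail_in C r.
Proof.
move=> fS; have [r0 ray0 E] := set_mem (valP (eps : set_type _)).
have [C [cC r0C _]] := ray_end_equiv ray0 fS.
exists C; split=> // r; rewrite -E => -[_ /(_ _ fS) [C' [cC' r0C' rC']]].
have [x [Cx C'x]] := has_tail_in_meet r0C r0C'.
have [n rn] := rC'; exists n => i /rn.
exact: (sub_component (@subset_refl _ S) cC cC' Cx C'x).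
Qed.

Lemma end_openT (X : graph) : @end_open X setT.
Proof.
move=> eps _; have [C [cC epsC]] := end_component eps (finite_set0 X).
exists [set eta | forall r, val eta r -> has_tail_in C r]; split=> //.
by exists set0, C.
Qed.

Lemma end_openI (X : graph) : setI_closed (@end_open X).
Proof.
move=> A B oA oB eps [/oA [_ [[S [C [fS cC ->]]] epsC CA]]].
move=> /oB [_ [[S' [C' [fS' cC' ->]]] epsC' CB]].
have fSS' : finite_set (S `|` S') by rewrite finite_setU.
have [D [cD epsD]] := end_component eps fSS'.
have [r0 ray0 E] := set_mem (valP (eps : set_type _)).
have er0 : val eps r0 by rewrite -E; split=> //; exact: ray_end_equiv.
have [x [Cx Dx]] := has_tail_in_meet (epsC _ er0) (epsD _ er0).
have [y [Cy Dy]] := has_tail_in_meet (epsC' _ er0) (epsD _ er0).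
have DC := sub_component (@subsetUl _ S S') cC cD Cx Dx.
have DC' := sub_component (@subsetUr _ S S') cC' cD Cy Dy.
exists [set eta | forall r, val eta r -> has_tail_in D r]; split=> //.
  by exists (S `|` S'), D.
move=> eta etaD; split; [apply: CA|apply: CB] => r /etaD [n rn].
  by exists n => i /rn /DC.
by exists n => i /rn /DC'.
Qed.

Lemma end_open_bigU (X : graph) (I : Type) (f : I -> set (end_space X)) :
  (forall i, end_open (f i)) -> end_open (\bigcup_i f i).
Proof.
move=> of_ eps [i _ /of_ [U [bU Ueps Uf]]].
by exists U; split=> // eta /Uf fi; exists i.
Qed.

HB.instance Definition _ (X : graph) :=
  isOpenTopological.Build (end_space X) (@end_openT X) (@end_openI X)
    (@end_open_bigU X).

(* Stated for topological spaces since measurableType requires a point, whereas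
   boundaries may be empty.  For second countable Y, the Borel sets of Y * Y are
   those of the product sigma-algebra. *)
Definition borel (Y : topologicalType) : set (set Y) := <<s @open Y >>.

Definition equivalence (Y : Type) (E : Y -> Y -> Prop) : Prop :=
  [/\ forall x, E x x, forall x y, E x y -> E y x
    & forall x y z, E x y -> E y z -> E x z].

Definition finite_borel_equivalence (Y : topologicalType)
    (E : Y -> Y -> Prop) : Prop :=
  [/\ equivalence E,
      @borel (Y * Y)%type [set p | E p.1 p.2]
    & forall x, finite_set [set y | E x y]].

Definition borel_hyperfinite (Y : topologicalType) (E : Y -> Y -> Prop) : Prop :=
  exists F : nat -> Y -> Y -> Prop,
    [/\ forall n, finite_borel_equivalence (F n),
        forall n x y, F n x y -> F n.+1 x y
      & forall x y, E x y <-> exists n, F n x y].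

Definition automorphism (X : graph) : set (X -> X) :=
  [set g | bijective g /\ forall x y, adj (g x) (g y) = adj x y].

Definition aut_subgroup (X : graph) (G : set (X -> X)) : Prop :=
  [/\ G `<=` @automorphism X,
      G id,
      forall g h, G g -> G h -> G (g \o h)
    & forall g, G g -> exists h, [/\ G h, cancel g h & cancel h g]].

(* The image in Aut(X[A]) of a group H that preserves A. *)
Definition restrict_to (X : graph) (A : set X) (H : set (X -> X)) :
    set (induced A -> induced A) :=
  [set h | exists2 g, H g & forall x, incl (h x) = g (incl x)].

(* Self-maps of V act on classes of rays by postcomposition. *)
Definition orbit_relation (V : Type) (B : set (set (nat -> V)))
    (G : set (V -> V)) (xi eta : B) : Prop :=
  exists2 g, G g & val eta = [set g \o r | r in val xi].

Definition boundary_orbit (X : graph) (G : set (X -> X)) :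
    gromov_boundary X -> gromov_boundary X -> Prop :=
  @orbit_relation X (@boundary_points X) G.

Definition end_orbit (X : graph) (G : set (X -> X)) :
    end_space X -> end_space X -> Prop :=
  @orbit_relation X (@ends X) G.

Definition edges (X : graph) : set (set X) :=
  [set e | exists u v, adj u v /\ e = [set u; v]].

Definition edge_orbits (X : graph) (G : set (X -> X)) : set (set (set X)) :=
  [set [set g @` e | g in G] | e in @edges X].

Section TreeDecompositions.
Variables (X T : graph) (beta : T -> set X).

Definition tree_decomposition : Prop :=
  [/\ is_tree T,
      forall x, exists t, beta t x,
      forall x y, adj x y -> exists t, beta t x /\ beta t y
    & forall x, graph_connected (induced [set t | beta t x])].

Definition finite_adhesion : Prop :=
  forall u v, adj u v -> finite_set (beta u `&` beta v).

(* The values of [act] outside G are irrelevant. *)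
Definition acts_on_tree (G : set (X -> X)) (act : (X -> X) -> T -> T) : Prop :=
  [/\ forall g, G g -> automorphism (act g),
      act id = id
    & forall g h, G g -> G h -> act (g \o h) = act g \o act h].

Definition invariant_decomposition (G : set (X -> X))
    (act : (X -> X) -> T -> T) : Prop :=
  acts_on_tree G act /\ forall g t, G g -> beta (act g t) = g @` beta t.

Definition stabilizer (G : set (X -> X)) (act : (X -> X) -> T -> T) (t : T) :
    set (X -> X) :=
  [set g | G g /\ act g t = t].

(* For an edge e = uv, the side of e containing u. *)
Definition side (u v : T) : set X :=
  \bigcup_(s in [set s : T | @reachable (edge_deleted u v) u s]) beta s.

(* Both sides of e are covered, since (u, v) and (v, u) both range over the
   edges. *)
Definition end_essential : Prop :=
  forall u v, adj u v ->
  exists2 eps, @ends X eps & forall r, eps r -> has_tail_in (side u v) r.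

End TreeDecompositions.

(* Main.v *)
(* Each side of an edge of T is a clopen set of boundary points, since a geodesic
   ray eventually avoids the finite adhesion set.  A boundary point thus orients
   every edge of T: either all edges at some vertex t point to t, and then the point
   lies in the limit set of the bag at t, or following the orientation gives an end
   of T.  Up to the action there are finitely many adhesion sets, so a detour out of
   a bag through an adhesion set can be replaced by a path of bounded length inside
   the bag: bags are quasi-isometrically embedded, and by stability of
   quasi-geodesics the boundary of X_t is homeomorphic to a closed subset of the
   boundary of X, these subsets being disjoint for distinct t.  Adhesion sets also
   have bounded diameter, so two rays crossing the adhesion sets along the same ray
   of T are equivalent, and the partial map from the boundary of X to the ends of T
   is injective.  All these maps are equivariant and continuous in both directions,
   and finite Borel subequivalence relations pull back along them; countably many
   translates of a bag share one representative, and using only the first n of them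
   at stage n keeps the classes finite.  When the decomposition is end-essential,
   geodesics to points further and further out on a ray of T accumulate on a preimage
   of its end, so the map to the ends of T is onto. *)
From mathcomp Require Import all_boot all_order all_algebra zify.
From mathcomp Require Import all_classical topology measure.
From mathcomp Require lra.
Require Import Defs.

Set Implicit Arguments.
Unset Strict Implicit.
Unset Printing Implicit Defensive.

Local Open Scope classical_set_scope.

(** * Path metrics and limits of geodesics *)

(** Local finiteness is available in [X] and in its bags, whereas [T] may have vertices of infinite
    degree. Every limit is therefore a limit of geodesics in [X] or in a bag, and openness is tested
    on sequences of rays that agree with a given ray for longer and longer times. Borel relations
    live on a product topology whose Borel sets are not shown to be generated by rectangles; hence
    maps are transported by continuity, and the diagonal of the boundary is proved Borel by means of
    countably many closed shadows. Boundary maps are relations between classes, so partial maps and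
    inverses have the same form and no representatives are chosen. The metric estimates are in
    natural numbers: Gromov's inequality is doubled once and for all, and bags embed with Lipschitz
    constant 1 and no additive error. *)

Section Walks.
Variable X : graph.
Implicit Types (x y z : X).

Lemma has_walk0 x : has_walk x x 0.
Proof. by exists [::]. Qed.

Lemma has_walk_cat x y z m n :
  has_walk x y m -> has_walk y z n -> has_walk x z (m + n).
Proof.
move=> [p [pp <- <-]] [q [pq <- <-]].
by exists (p ++ q); rewrite cat_path last_cat size_cat pp pq.
Qed.

Lemma has_walk_sym x y n : has_walk x y n -> has_walk y x n.
Proof.
move=> [p [pp <- <-]]; exists (rev (belast x p)); split.
- by rewrite rev_path (eq_path (e' := @adj X)) // => ? ?; exact: adj_sym.
- by case: p {pp} => //= a p; rewrite rev_cons last_rcons.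
- by rewrite size_rev size_belast.
Qed.

Lemma adj_has_walk x y : adj x y -> has_walk x y 1.
Proof. by move=> xy; exists [:: y]; rewrite /= xy. Qed.

Lemma reachable_refl x : reachable x x.
Proof. by exists 0; exact: has_walk0. Qed.

Lemma reachable_trans x y z : reachable x y -> reachable y z -> reachable x z.
Proof. by move=> [m xy] [n yz]; exists (m + n); exact: has_walk_cat xy yz. Qed.

Lemma reachable_sym x y : reachable x y -> reachable y x.
Proof. by move=> [n xy]; exists n; exact: has_walk_sym. Qed.

Lemma adj_reachable x y : adj x y -> reachable x y.
Proof. by move=> /adj_has_walk; exists 1. Qed.

Lemma dist_le x y n : has_walk x y n -> dist x y <= n.
Proof.
move=> xy; rewrite /dist; case: pselect => [e|//].
by case: ex_minnP => m _; apply; apply/asboolP.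
Qed.

Lemma dist_walk x y : reachable x y -> has_walk x y (dist x y).
Proof.
move=> [n xy]; rewrite /dist; case: pselect => [e|[]]; last first.
  by exists n; apply/asboolP.
by case: ex_minnP => m /asboolP.
Qed.

Lemma distxx x : dist x x = 0.
Proof. by apply/eqP; rewrite -leqn0; exact/dist_le/has_walk0. Qed.

Lemma dist_adj_le x y : adj x y -> dist x y <= 1.
Proof. by move=> /adj_has_walk /dist_le. Qed.

End Walks.

Section Metric.
Variable X : graph.
Hypothesis X_connected : graph_connected X.
Implicit Types (x y z : X) (r s : nat -> X).

Lemma dist_sym x y : dist x y = dist y x.
Proof.
have le (a b : X) : dist a b <= dist b a.
  exact/dist_le/has_walk_sym/(dist_walk (X_connected b a)).
by apply/eqP; rewrite eqn_leq !le.
Qed.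

Lemma dist_triangle y x z : dist x z <= dist x y + dist y z.
Proof.
exact/dist_le/(has_walk_cat (dist_walk (X_connected x y)))/dist_walk/X_connected.
Qed.

Lemma dist_eq0 x y : dist x y = 0 -> x = y.
Proof. by move=> xy0; have := dist_walk (X_connected x y); rewrite xy0 => -[[|a p] [_ xy //]]. Qed.

Lemma dist_eq1 x y : dist x y = 1 -> adj x y.
Proof.
move=> xy1; have := dist_walk (X_connected x y).
rewrite xy1 => -[[|a [|b p]] [pp lp //= _]].
by move: pp; rewrite -lp /= andbT.
Qed.

Lemma adj_dist x y : adj x y -> dist x y = 1.
Proof.
move=> xy; have := dist_adj_le xy; case E : (dist x y) => [|[|//]] // _.
by move: xy; rewrite (dist_eq0 E) adj_irrefl.
Qed.

Lemma lipschitz_dist r n : (forall i, i < n -> dist (r i) (r i.+1) <= 1) ->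
  forall i j, i <= j -> j <= n -> dist (r i) (r j) <= j - i.
Proof.
move=> lip i; elim=> [|j IH] ij jn; first by (have -> : i = 0 by lia); rewrite distxx.
have [-> |ij'] : i = j.+1 \/ i <= j by lia.
  by rewrite distxx.
by have := dist_triangle (r j) (r i) (r j.+1); have := IH ij'; have := lip j; lia.
Qed.

Definition geodesic_upto n : set (nat -> X) :=
  [set r | forall i j, i <= j -> j <= n -> dist (r i) (r j) = j - i].

Lemma geodesic_upto_le m n r : m <= n -> geodesic_upto n r -> geodesic_upto m r.
Proof. by move=> mn gr i j ij jm; apply: gr => //; lia. Qed.

Lemma geodesic_ray_upto n r : geodesic_ray r -> geodesic_upto n r.
Proof. by move=> gr i j ij _; exact: gr. Qed.

Lemma geodesic_segment x y : exists r,
  [/\ r 0 = x, r (dist x y) = y & geodesic_upto (dist x y) r].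
Proof.
have [p [pp lp sp]] := dist_walk (X_connected x y).
exists (nth y (x :: p)); rewrite -sp; split=> //; first by rewrite nth_last.
have lip i : i < size p -> dist (nth y (x :: p) i) (nth y (x :: p) i.+1) <= 1.
  by move=> ip; apply/dist_adj_le; exact: (pathP y pp).
have le := lipschitz_dist lip; move=> i j ij jp.
have := dist_triangle (nth y (x :: p) i) x y.
have := dist_triangle (nth y (x :: p) j) (nth y (x :: p) i) y.
have := le 0 i; have := le i j; have := le j (size p).
by rewrite nth_last /= lp; lia.
Qed.

Lemma geodesic_adj n r i : geodesic_upto n r -> i < n -> adj (r i) (r i.+1).
Proof. by move=> gr i_n; apply: dist_eq1; rewrite gr //; lia. Qed.

Lemma geodesic_dist r i j : geodesic_ray r -> dist (r i) (r j) = (i - j) + (j - i).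
Proof.
move=> gr; have [ij|ji] := leqP i j; first by rewrite gr //; lia.
by rewrite dist_sym gr; lia.
Qed.

Lemma geodesic_inj r : geodesic_ray r -> injective r.
Proof.
by move=> gr i j rij; have := geodesic_dist i j gr; rewrite rij distxx; lia.
Qed.

Lemma geodesic_ray_ray r : geodesic_ray r -> ray r.
Proof.
move=> gr; split; first exact: geodesic_inj.
by move=> i; apply: dist_eq1; rewrite gr //; lia.
Qed.

Lemma finite_set_dist_bound x (S : set X) : finite_set S ->
  exists M, forall a, S a -> dist x a <= M.
Proof.
move=> /finite_seqP [s ->]; exists (\max_(a <- s) dist x a) => a /= as_.
exact: leq_bigmax_seq.
Qed.

Lemma finite_ball x n : locally_finite X -> finite_set [set y | dist x y <= n].
Proof.
move=> lf; elim: n => [|n IH].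
  apply: (@sub_finite_set _ _ [set x]); last exact: finite_set1.
  by move=> y /=; rewrite leqn0 => /eqP /dist_eq0.
apply: (@sub_finite_set _ _ ([set y | dist x y <= n] `|`
    \bigcup_(a in [set y | dist x y <= n]) [set y | adj a y])).
  move=> y /= yn; have [r [r0 rn gr]] := geodesic_segment x y.
  have [yn'|yn'] := leqP (dist x y) n; [by left|right].
  exists (r n); first by rewrite /= -r0 gr; lia.
  by rewrite /= -rn (_ : dist x y = n.+1); [apply: geodesic_adj gr _|]; lia.
by rewrite finite_setU; split=> //; apply: bigcup_finite => // a _; exact: lf.
Qed.

Lemma countable_graph : locally_finite X -> countable [set: X].
Proof.
move=> lf; have [[x]|nX] := pselect (inhabited X); last first.
  by rewrite (_ : [set: X] = set0) //; apply/seteqP; split=> // x _; case: nX.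
have -> : [set: X] = \bigcup_n [set y | dist x y <= n].
  by apply/seteqP; split=> // y _; exists (dist x y) => /=.
by apply: bigcup_countable => // n _; exact/finite_set_countable/finite_ball.
Qed.

End Metric.

(** A prefix is kept as long as [f n] agrees with it for arbitrarily large [n]; only finitely many
    values are possible at the next place, so one of them keeps this property. *)
Lemma koenig (V : Type) (B : nat -> set V) (f : nat -> nat -> V) :
  (forall i, finite_set (B i)) -> (forall n i, i <= n -> B i (f n i)) ->
  exists g, forall N, exists n, N <= n /\ forall i, i <= N -> f n i = g i.
Proof.
move=> fB Bf; pose V' := {classic V}.
pose good k (h : nat -> V) := forall N, exists n, N <= n /\ forall i, i < k -> f n i = h i.
have ext k h : good k h -> exists v, good k.+1 (fun i => if i == k then v else h i).
  move=> gh; apply/not_existsP => H.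
  have {}H v : exists N, forall n, N <= n -> ~ forall i, i < k.+1 ->
      f n i = if i == k then v else h i.
    have /existsNP[N /forallNP nN] := H v; exists N => n Nn nk; exact: (nN n).
  have [N HN] := choice H.
  have [M HM] : exists M, forall v, B k v -> N v <= M.
    have /(finite_image N) /finite_seqP [s Es] := fB k.
    exists (\max_(a <- s) a) => v Bv.
    have : [set` s] (N v) by rewrite -Es; exists v.
    by move=> /= Ns; exact: leq_bigmax_seq.
  have [n [nM nk]] := gh (maxn k M).
  have Bn : B k (f n k) by apply: Bf; lia.
  apply: (HN (f n k) n); first by have := HM _ Bn; lia.
  by move=> i ik; case: eqP => [-> //|?]; apply: nk; lia.
have [n0 _] : exists v : nat -> V, good 0 v.
  by exists (f 0) => N; exists N.
(* Totalised for [choice]: a prefix that is not good receives the arbitrary value [n0 0]. *)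
have /choice [F HF] : forall kh : nat * (nat -> V), exists v, good kh.1 kh.2 ->
    good kh.1.+1 (fun i => if i == kh.1 then v else kh.2 i).
  move=> [k h]; have [/ext[v gv]|ng] := pselect (good k h); first by exists v.
  by exists (n0 0).
pose step kh := (kh.1.+1, fun i => if i == kh.1 then F kh else kh.2 i) : nat * (nat -> V).
pose S k := iter k step (0, n0).
have S1 k : (S k).1 = k by elim: k => //= k ->.
have Sg k : good k (S k).2.
  elim: k => [N|k IH]; first by exists N.
  by have := HF (S k); rewrite S1 => /(_ IH); rewrite /S /= -/(S k) S1.
have Sst k m i : i < k -> k <= m -> (S m).2 i = (S k).2 i.
  move=> ik; elim: m => [|m IH] km; first by (have ? : k = 0 by lia); lia.
  have [-> //|km'] : k = m.+1 \/ k <= m by lia.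
  by rewrite /S /= -/(S m) S1; case: eqP => [?|_]; [lia|exact: IH].
exists (fun i => (S i.+1).2 i) => N; have [n [Nn nN]] := Sg N.+1 N.
by exists n; split=> // i iN; rewrite nN //; rewrite (Sst i.+1 N.+1).
Qed.

(** Arzela-Ascoli for geodesics from a fixed vertex: the [i]-th vertices lie in a ball of radius
    [i], which is finite. *)
Lemma geodesic_limit (X : graph) (x0 : X) (f : nat -> nat -> X) :
  graph_connected X -> locally_finite X -> (forall n, f n 0 = x0) ->
  (forall n, geodesic_upto n (f n)) ->
  exists g, [/\ g 0 = x0, geodesic_ray g
    & forall N, exists n, N <= n /\ forall i, i <= N -> f n i = g i].
Proof.
move=> X_conn lf f0 gf.
have [||g Hg] := @koenig X (fun i => [set y | dist x0 y <= i]) f.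
- by move=> i; exact: finite_ball.
- by move=> n i i_n /=; rewrite -(f0 n) gf //; lia.
exists g; split=> //.
- by have [n [_ <-]] := Hg 0; rewrite ?f0.
- by move=> i j ij; have [n [jn fg]] := Hg j; rewrite -!fg //; exact: gf.
Qed.

(** * Hyperbolic graphs and stability of quasi-geodesics *)

(* Gromov's product inequality, cleared of denominators. *)
Definition four_point (X : graph) (D : nat) : Prop := forall w x y z : X,
  dist x z + dist y w <= dist x y + dist z w + D \/
  dist x z + dist y w <= dist y z + dist x w + D.

Section FourPoint.
Import GRing.Theory Num.Theory Order.TTheory lra.
Local Open Scope ring_scope.

(** Doubling clears the halves in the Gromov products; [D] is an integer above [2 * delta], and the
    minimum becomes the disjunction. *)
Lemma hyperbolic_four_point (X : graph) : hyperbolic X -> exists D, four_point X D.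
Proof.
move=> [delta hyp]; exists (Num.bound `|2 * delta|) => w x y z.
have ltD : 2 * delta < (Num.bound `|2 * delta|)%:R.
  by apply: le_lt_trans (ler_norm _) _; apply: archi_boundP.
move: (Num.bound _) ltD => D ltD.
have := hyp w x y z; rewrite lerBlDr ge_min /gromov_product => /orP[le|le];
  [left|right]; rewrite -(ler_nat rat) !natrD; lra.
Qed.

End FourPoint.

Section HausdorffDistance.
Variable X : graph.
Hypothesis X_connected : graph_connected X.
Implicit Types (r s : nat -> X).
Local Notation fhd := (@finite_hausdorff_distance X).

Lemma fhd_refl r : fhd r r.
Proof. by exists 0; split=> i; exists i; rewrite distxx. Qed.

Lemma fhd_sym r s : fhd r s -> fhd s r.
Proof.
by move=> [K [rs sr]]; exists K; split=> i; [have [j] := sr i|have [j] := rs i];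
  rewrite dist_sym //; exists j.
Qed.

Lemma fhd_trans r s t : fhd r s -> fhd s t -> fhd r t.
Proof.
move=> [K [rs sr]] [L [st ts]]; exists (K + L); split=> i.
  have [j rj] := rs i; have [k sk] := st j; exists k.
  by have := dist_triangle X_connected (s j) (r i) (t k); lia.
have [j sj] := ts i; have [k rk] := sr j; exists k.
by have := dist_triangle X_connected (s j) (r k) (t i); lia.
Qed.

Lemma fhd_pointwise r s C : (forall i, dist (r i) (s i) <= C) -> fhd r s.
Proof. by move=> rs; exists C; split=> i; exists i. Qed.

(** If [s j] is within [C] of [r i], comparing distances to the starting points shows that [i] and
    [j] differ by at most [C + dist (r 0) (s 0)]. *)
Lemma near_pointwise r s C : geodesic_ray r -> geodesic_ray s ->
  (forall i, exists j, dist (r i) (s j) <= C) ->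
  forall i, dist (r i) (s i) <= 2 * C + dist (r 0) (s 0).
Proof.
move=> gr gs rs i; have [j rj] := rs i.
have := geodesic_dist X_connected 0 i gr.
have := geodesic_dist X_connected 0 j gs.
have := geodesic_dist X_connected j i gs.
have := dist_triangle X_connected (s j) (r i) (s i).
have := dist_triangle X_connected (r i) (r 0) (s j).
have := dist_triangle X_connected (s 0) (r 0) (s j).
have := dist_triangle X_connected (r 0) (s 0) (s j).
have := dist_triangle X_connected (s j) (r 0) (r i).
rewrite (dist_sym X_connected (s 0) (r 0)) (dist_sym X_connected (s j) (r i)).
by lia.
Qed.

Lemma fhd_near_pointwise r s : geodesic_ray r -> geodesic_ray s -> fhd r s ->
  exists C, forall i, dist (r i) (s i) <= C.
Proof.
by move=> gr gs [C [rs _]]; exists (2 * C + dist (r 0) (s 0)) => i; exact: near_pointwise.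
Qed.

End HausdorffDistance.

Lemma linear_le_exp C m : 2 * C <= m -> C * m <= 2 ^ m.
Proof.
move=> Cm; rewrite -(subnKC Cm); elim: (m - 2 * C) => [|k IH].
  rewrite addn0 mul2n -addnn expnD; apply: leq_mul; first exact/ltnW/ltn_expl.
  case: C {Cm} => // C; rewrite expnS.
  by have : C < 2 ^ C by [exact: ltn_expl]; lia.
have : C < 2 ^ C by exact: ltn_expl.
have : 2 ^ C <= 2 ^ (2 * C + k) by rewrite leq_exp2l //; lia.
by rewrite addnS expnS; lia.
Qed.

(** * Fellow travelling and stability of quasi-geodesics *)

Section Hyperbolic.
Variables (X : graph) (D : nat).
Hypothesis X_connected : graph_connected X.
Hypothesis X_four_point : four_point X D.
Implicit Types (x y z : X) (r s q : nat -> X).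
Local Notation tri := (dist_triangle X_connected).
Local Notation dsym := (dist_sym X_connected).

(** Two four-point inequalities based at [r 0], for [r i], [r n], [s m] and for [r i], [s m], [s i],
    cost [D] each. The margin [i + E + D] excludes the alternative involving [E], so the bound is
    independent of [E]. *)
Lemma fellow_travel r s n m E i :
  geodesic_upto n r -> geodesic_upto m s -> dist (r n) (s m) <= E ->
  i + E + D + dist (r 0) (s 0) < n ->
  i <= m /\ dist (r i) (s i) <= dist (r 0) (s 0) + 2 * D.
Proof.
move=> gr gs rsE i_n.
have r0n := gr 0 n (leq0n _) (leqnn _); have s0m := gs 0 m (leq0n _) (leqnn _).
have i_m : i <= m.
  have := tri (s 0) (r 0) (s m); have := tri (s m) (r 0) (r n).
  by rewrite (dsym (s m) (r n)); lia.
split=> //; have i_n' : i <= n by lia.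
have r0i := gr 0 i (leq0n _) i_n'; have rin := gr i n i_n' (leqnn _).
have s0i := gs 0 i (leq0n _) i_m; have sim := gs i m i_m (leqnn _).
have := tri (s 0) (r 0) (s i); have := tri (r 0) (s 0) (s m).
have := X_four_point (r 0) (r i) (r n) (s m).
have := X_four_point (r 0) (r i) (s m) (s i).
rewrite !(dsym _ (r 0)) (dsym (s m) (s i)).
by lia.
Qed.

Lemma ray_fellow_travel r s E : geodesic_ray r -> geodesic_ray s ->
  (forall N, exists i j, N <= i /\ dist (r i) (s j) <= E) ->
  forall i, dist (r i) (s i) <= dist (r 0) (s 0) + 2 * D.
Proof.
move=> gr gs near i.
have [n [m [Nn rsE]]] := near (i + E + D + dist (r 0) (s 0)).+1.
by have [] := @fellow_travel r s n m E i (geodesic_ray_upto gr) (geodesic_ray_upto gs) rsE Nn.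
Qed.

Lemma fhd_fellow_travel r s : geodesic_ray r -> geodesic_ray s ->
  finite_hausdorff_distance r s ->
  forall i, dist (r i) (s i) <= dist (r 0) (s 0) + 2 * D.
Proof.
move=> gr gs [C [rs _]]; apply: (@ray_fellow_travel _ _ C) => // N.
by have [j rj] := rs N; exists N, j.
Qed.

(** The second hypothesis says that consecutive points have doubled Gromov product at least [m] at
    [x]. Each halving of the chain costs one four-point inequality, hence [D] per level; the last
    hypothesis, the product of a point with itself, serves chains of length 0. *)
Lemma gromov_chain x m : forall N L q, L <= 2 ^ N ->
  (forall i, i < L -> m + dist (q i) (q i.+1) <= dist (q i) x + dist (q i.+1) x) ->
  (forall i, i <= L -> m <= 2 * dist (q i) x) ->
  m + dist (q 0) (q L) <= dist (q 0) x + dist (q L) x + N * D.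
Proof.
elim=> [|N IH] L q LN qS qm.
  case: L LN qS qm => [_ _ /(_ 0 isT)|[|//] _ /(_ 0 isT)]; rewrite ?distxx; lia.
rewrite expnS in LN; pose L1 := L./2.
have := IH L1 q; have := IH (L - L1) (fun i => q (L1 + i)).
rewrite addn0 subnKC; last by lia.
move=> H1 H2.
have := X_four_point x (q 0) (q L1) (q L).
have : m + dist (q 0) (q L1) <= dist (q 0) x + dist (q L1) x + N * D.
  by apply: H2 => [|i ?|i ?]; [lia|apply: qS; lia|apply: qm; lia].
have : m + dist (q L1) (q L) <= dist (q L1) x + dist (q L) x + N * D.
  by apply: H1 => [|i ?|i ?]; [lia|rewrite addnS; apply: qS; lia|apply: qm; lia].
by lia.
Qed.

(** Prepares the contradiction in [morse]: a chain of at most [6 * K * M] steps needs [N] halvings,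
    and [N + 2] losses of [D] must stay below [2 * M - 1]. *)
Lemma morse_constant K : exists M0, forall M, M0 <= M ->
  exists N, 6 * K * M <= 2 ^ N /\ 1 + (N + 2) * D < 2 * M.
Proof.
(* With [N = m - 2], the bounds [M < (m + 1) * D.+1] and [m + 1 <= 3 * (m - 2)] give
   [6 * K * M <= C * N], whence 18 = 6 * 3. The second bound fails only for [m = 3], where [C] and
   hence [K] vanish. *)
pose C := 18 * K * D.+1.
exists ((2 * C + 3) * D.+1) => M M0M.
pose m := M %/ D.+1.
have mM : m * D.+1 <= M by rewrite leq_divM.
have Mm : M < (m + 1) * D.+1 by rewrite addn1 ltn_ceil.
have Cm : 2 * C + 3 <= m by rewrite leq_divRL.
exists (m - 2); split; last by nia.
apply: leq_trans (@linear_le_exp C (m - 2) _); last by lia.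
have : m + 1 <= 3 * (m - 2) \/ m = 3 by lia.
rewrite /C; case=> [le|m3]; first by nia.
have C0 : C = 0 by lia.
have : K = 0 by rewrite /C in C0; nia.
by move=> ->.
Qed.

(* Stability of quasi-geodesics, in the direction "the geodesic stays near the
   quasi-geodesic".  At the point x of the geodesic furthest from q, at distance
   M, the detour along q between points at distance 2M on both sides of x has
   length O(M) but stays out of the ball of radius M around x, whereas
   gromov_chain forces it to have length exponential in M. *)
Lemma morse K : exists D1, forall q n r l,
  (forall i, i < n -> dist (q i) (q i.+1) <= 1) ->
  (forall i j, i <= j -> j <= n -> j - i <= K * dist (q i) (q j)) ->
  geodesic_upto l r -> r 0 = q 0 -> r l = q n ->
  forall i, i <= l -> exists2 j, j <= n & dist (r i) (q j) <= D1.
Proof.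
have [M0 HM0] := morse_constant K; exists M0 => q n r l q1 qK gr r0 rl.
pose P M := forall i, i <= l -> exists2 j, j <= n & dist (r i) (q j) <= M.
have exP : exists M, `[< P M >].
  by exists l; apply/asboolP => i il; exists 0 => //; rewrite -r0 dsym gr; lia.
case: (ex_minnP exP) => M /asboolP PM Mmin.
suff MM0 : M <= M0.
  by move=> i il; have [j jn ij] := PM i il; exists j => //; lia.
rewrite leqNgt; apply/negP => M0M.
(* By minimality of [M]: otherwise all of the geodesic would be within [M.-1] of [q]. *)
have [x0 x0l x0far] : exists2 i0, i0 <= l & forall j, j <= n -> M <= dist (r i0) (q j).
  apply: contrapT => /forall2NP H.
  have : M <= M.-1; last by lia.
  apply: Mmin; apply/asboolP => i il; have [//|/existsNP [j /not_implyP[jn far]]] := H i.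
  by exists j => //; lia.
have [N [LN ND]] := HM0 M (ltnW M0M).
(* Go back by [2 * M], or to the start, where [r] and [q] agree. Either way the doubled product of
   [r a] and [q ja] at [r x0] is at least [2 * M]; [b] is the mirror image. *)
have [a [ja [al jan a1 a2 a3]]] : exists a ja, [/\ a <= x0, ja <= n, x0 - a <= 2 * M,
     dist (r a) (q ja) <= M
   & 2 * M + dist (r a) (q ja) <= dist (r a) (r x0) + dist (q ja) (r x0)].
  have [le|lt] := leqP (2 * M) x0.
    have [|j jn aj] := PM (x0 - 2 * M); first by lia.
    exists (x0 - 2 * M), j; split=> //; try lia.
    by rewrite gr; try lia; have := x0far j jn; rewrite dsym; lia.
  exists 0, 0; split=> //; rewrite ?r0 ?distxx; try lia.
  by have := x0far 0 (leq0n _); rewrite dsym; lia.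
have [b [jb [bl jbn b1 b2 b3]]] : exists b jb, [/\ x0 <= b <= l, jb <= n, b - x0 <= 2 * M,
     dist (r b) (q jb) <= M
   & 2 * M + dist (r b) (q jb) <= dist (r b) (r x0) + dist (q jb) (r x0)].
  have [le|lt] := leqP (x0 + 2 * M) l.
    have [|j jn aj] := PM (x0 + 2 * M); first by lia.
    exists (x0 + 2 * M), j; split=> //; try lia.
    by rewrite (dsym (r _) (r x0)) gr; try lia; have := x0far j jn; rewrite dsym; lia.
  exists l, n; split=> //; rewrite ?rl ?distxx; try lia.
  by have := x0far n (leqnn _); rewrite dsym; lia.
have ab : dist (r a) (r b) = dist (r a) (r x0) + dist (r b) (r x0).
  by rewrite (dsym (r b) (r x0)) !gr; lia.
have dab : dist (r a) (r b) <= 4 * M by rewrite gr; lia.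
(* Points of [q] are at distance at least [M] from [r x0] and consecutive ones at most 1 apart,
   hence the threshold [2 * M - 1]. The quasi-geodesic inequality bounds the number of steps by
   [6 * K * M]. *)
have chain i j : i <= j -> j <= n -> dist (q i) (q j) <= 6 * M ->
    2 * M - 1 + dist (q i) (q j) <= dist (q i) (r x0) + dist (q j) (r x0) + N * D.
  move=> ij jn dij.
  have := @gromov_chain (r x0) (2 * M - 1) N (j - i) (fun k => q (i + k)).
  rewrite addn0 subnKC //; apply.
  - by apply: leq_trans LN; have := qK i j ij jn; nia.
  - move=> k kj; have ikn : i + k < n by lia.
    have ikn' : i + k.+1 <= n by lia.
    rewrite -addnS in ikn; have := q1 (i + k); rewrite -addnS.
    have := x0far (i + k); have := x0far (i + k.+1).
    by rewrite (dsym (r x0)) (dsym (r x0)); lia.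
  - by move=> k kj; have := x0far (i + k); rewrite dsym; lia.
have dj : dist (q ja) (q jb) <= 6 * M.
  have := tri (r a) (q ja) (q jb); have := tri (r b) (r a) (q jb).
  by rewrite (dsym (q ja) (r a)); lia.
have Gj : 2 * M - 1 + dist (q ja) (q jb) <=
    dist (q ja) (r x0) + dist (q jb) (r x0) + N * D.
  have [le|/ltnW le] := leqP ja jb; first exact: chain.
  by have := chain jb ja le jan; rewrite (dsym (q jb)); lia.
(* [r x0] lies between [r a] and [r b], so their product there is 0; the products along [r a],
   [q ja], [q jb], [r b], minus two more losses of [D], would make it positive. *)
have := X_four_point (r x0) (r a) (q ja) (q jb).
have := X_four_point (r x0) (r a) (q jb) (r b).
by rewrite (dsym (q jb) (r b)); lia.
Qed.

End Hyperbolic.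

(** * Boundary maps of quasi-isometric embeddings *)

Section Boundary.
Variable X : graph.
Hypothesis X_connected : graph_connected X.
Implicit Types (xi eta : gromov_boundary X) (r s : nat -> X).

Lemma boundaryE xi : exists2 r, geodesic_ray r &
  val xi = [set s | geodesic_ray s /\ finite_hausdorff_distance r s].
Proof. by have [r gr <-] := set_mem (valP (xi : set_type _)); exists r. Qed.

Lemma boundary_inhabited xi : exists r, val xi r.
Proof. by have [r gr ->] := boundaryE xi; exists r; split=> //; exact: fhd_refl. Qed.

Lemma boundary_geodesic xi r : val xi r -> geodesic_ray r.
Proof. by have [s _ ->] := boundaryE xi => -[]. Qed.

Lemma boundary_fhd xi r s : val xi r -> val xi s -> finite_hausdorff_distance r s.
Proof.
have [t _ ->] := boundaryE xi => -[_ tr] [_ ts].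
by apply: fhd_trans ts => //; exact: fhd_sym.
Qed.

Lemma boundary_mem xi r s : val xi r -> geodesic_ray s ->
  finite_hausdorff_distance r s -> val xi s.
Proof.
have [t _ ->] := boundaryE xi => -[_ tr] gs rs; split=> //.
exact: fhd_trans tr rs.
Qed.

Lemma boundary_eq xi eta r : val xi r -> val eta r -> xi = eta.
Proof.
move=> xir etar; apply: val_inj; apply/seteqP; split=> s rs.
- exact: boundary_mem etar (boundary_geodesic rs) (boundary_fhd xir rs).
- exact: boundary_mem xir (boundary_geodesic rs) (boundary_fhd etar rs).
Qed.

Lemma boundary_class r : geodesic_ray r -> exists xi, val xi r.
Proof.
move=> gr; pose C := [set s | geodesic_ray s /\ finite_hausdorff_distance r s].
have CX : C \in @boundary_points X by rewrite inE; exists r.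
by exists (exist _ C CX); split=> //; exact: fhd_refl.
Qed.

Lemma boundary_openE (W : set (gromov_boundary X)) : open W = boundary_open W.
Proof. by []. Qed.

(** If [W] were not open at [r], every time [n] would give a class outside [W] with a representative
    following [r] up to [n]. Choosing these makes openness a question about limits, for
    [geodesic_limit] to answer. *)
Lemma boundary_open_seq (W : set (gromov_boundary X)) :
  (forall xi r (eta : nat -> gromov_boundary X) (s : nat -> nat -> X),
    W xi -> val xi r -> (forall n, val (eta n) (s n)) ->
    (forall n i, i <= n -> s n i = r i) -> exists n, W (eta n)) ->
  open W.
Proof.
rewrite boundary_openE => H xi r Wxi xir; apply: contrapT => /forallNP nW.
have {}nW n : exists es : gromov_boundary X * (nat -> X),
    [/\ val es.1 es.2, forall i, i <= n -> es.2 i = r i & ~ W es.1].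
  have /existsNP[eta /existsNP[s /not_implyP[etas /not_implyP[sr nWe]]]] := nW n.
  by exists (eta, s).
have [F HF] := choice nW.
have [||n] := H xi r (fun n => (F n).1) (fun n => (F n).2) Wxi xir.
- by move=> n; have [] := HF n.
- by move=> n; have [] := HF n.
by have [] := HF n.
Qed.

End Boundary.

(* Continuity of the partial function with graph R, for the subspace topology on
   its domain. *)
Definition rel_continuous (Y Z : topologicalType) (R : Y -> Z -> Prop) : Prop :=
  forall U, open U -> exists2 W, open W & forall y z, R y z -> (W y <-> U z).

Definition qi_embedding (Z X : graph) (K : nat) (f : Z -> X) : Prop :=
  forall a b, dist (f a) (f b) <= dist a b /\ dist a b <= K * dist (f a) (f b).

(* The graph of the map induced by f, with the value xi as first argument. *)
Definition boundary_map (Z X : graph) (f : Z -> X)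
    (xi : gromov_boundary X) (eta : gromov_boundary Z) : Prop :=
  exists r s, [/\ val xi r, val eta s & finite_hausdorff_distance r (f \o s)].

Section QuasiIsometricEmbedding.
Variables (X Z : graph) (K : nat) (f : Z -> X).
Hypothesis X_connected : graph_connected X.
Hypothesis X_locally_finite : locally_finite X.
Hypothesis X_hyperbolic : hyperbolic X.
Hypothesis Z_connected : graph_connected Z.
Hypothesis Z_locally_finite : locally_finite Z.
Hypothesis f_qi : qi_embedding K f.
Implicit Types (r : nat -> X) (s : nat -> Z).
Local Notation tri := (dist_triangle X_connected).
Local Notation dsym := (dist_sym X_connected).

Lemma qi_fhd s s' : finite_hausdorff_distance s s' ->
  finite_hausdorff_distance (f \o s) (f \o s').
Proof.
move=> [C [ss' s's]]; exists C; split=> i; [have [j] := ss' i|have [j] := s's i];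
  by exists j; exact: leq_trans (f_qi _ _).1 _.
Qed.

Lemma qi_fhd_inv s s' : finite_hausdorff_distance (f \o s) (f \o s') ->
  finite_hausdorff_distance s s'.
Proof.
move=> [C [ss' s's]]; exists (K * C); split=> i; [have [j] := ss' i|have [j] := s's i];
  by exists j; apply: leq_trans (f_qi _ _).2 _; rewrite leq_mul2l; apply/orP; right.
Qed.

(** The distance from [s 0] to [s j] is [j], and [f] contracts it by at most the factor [K]; so
    partners of [r i] cannot escape when limits are taken. *)
Lemma near_index_bound r s C i j : geodesic_ray s -> dist (r 0) (r i) <= i ->
  dist (r i) (f (s j)) <= C -> j <= K * (dist (r 0) (f (s 0)) + i + C).
Proof.
move=> gs r0i ij; have := gs 0 j (leq0n _); have [_] := f_qi (s 0) (s j).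
have := tri (r 0) (f (s 0)) (f (s j)); have := tri (r i) (r 0) (f (s j)).
rewrite (dsym (f (s 0)) (r 0)) subn0 => le1 le2 le3 <-.
by apply: leq_trans le3 _; rewrite leq_mul2l; apply/orP; right; lia.
Qed.

(* One-sided closeness suffices: the indices j_i with f (s j_i) close to r i make
   bounded jumps and tend to infinity, so every f (s j) is close to r. *)
Lemma near_fhd r s C : geodesic_ray r -> geodesic_ray s ->
  (forall i, exists j, dist (r i) (f (s j)) <= C) ->
  finite_hausdorff_distance r (f \o s).
Proof.
move=> gr gs rs; have [J HJ] := choice rs.
exists (C + J 0 + K * (2 * C + 1)); split=> [i|j].
  by exists (J i); rewrite /=; have := HJ i; lia.
have jump i : J i.+1 - J i <= K * (2 * C + 1).
  have [le|/ltnW le] := leqP (J i.+1) (J i); first by lia.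
  rewrite -(gs _ _ le); apply: leq_trans (f_qi _ _).2 _.
  rewrite leq_mul2l; apply/orP; right.
  have := tri (r i) (f (s (J i))) (f (s (J i.+1))).
  have := tri (r i.+1) (r i) (f (s (J i.+1))).
  have := HJ i; have := HJ i.+1; have := gr i i.+1 (leqnSn i).
  by rewrite (dsym (f (s (J i))) (r i)); lia.
have fs a b : a <= b -> dist (f (s a)) (f (s b)) <= b - a.
  by move=> ab; rewrite -(gs _ _ ab); exact: (f_qi _ _).1.
have exi : exists i, j < J i.
  pose i := (j + C + dist (r 0) (f (s 0))).+1; exists i; have := fs 0 (J i) (leq0n _); have := HJ i.
  have := gr 0 i (leq0n _); have := tri (f (s 0)) (r 0) (r i).
  have := tri (f (s (J i))) (f (s 0)) (r i).
  by rewrite (dsym (f (s (J i))) (r i)) /i; lia.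
case: (ex_minnP exi) => -[|i] ji imin.
  exists 0 => /=; have := HJ 0; have := fs j (J 0) (ltnW ji).
  have := tri (f (s (J 0))) (r 0) (f (s j)); rewrite (dsym (f (s (J 0)))).
  by lia.
have jJ : J i <= j by rewrite leqNgt; apply/negP => /imin; lia.
exists i => /=; have := HJ i; have := fs _ _ jJ; have := jump i.
have := tri (f (s (J i))) (r i) (f (s j)).
by lia.
Qed.

(** Apply [morse] to images of longer and longer initial pieces of [s] and take a limit of the
    geodesics between their endpoints. One [C] serves all rays. *)
Lemma qi_ray_near : exists C, forall s, geodesic_ray s -> exists r,
  [/\ geodesic_ray r, r 0 = f (s 0) & forall i, exists j, dist (r i) (f (s j)) <= C].
Proof.
have [D X4] := hyperbolic_four_point X_hyperbolic.
have [C HC] := morse X_connected X4 K; exists C => s gs.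
have seg n : exists r, [/\ r 0 = f (s 0), geodesic_upto n r
    & forall i, i <= n -> exists j, dist (r i) (f (s j)) <= C].
  (* Long enough for the endpoints to be at distance at least [n]; the successor covers [K = 0]. *)
  pose m := K.+1 * n.
  have [r [r0 rl gr]] := geodesic_segment X_connected (f (s 0)) (f (s m)).
  have nl : n <= dist (f (s 0)) (f (s m)).
    rewrite -(@leq_pmul2l K.+1) // -/m; have := (f_qi (s 0) (s m)).2.
    by rewrite gs // subn0 => le; apply: leq_trans le _; rewrite leq_mul2r leqnSn orbT.
  exists r; split=> //; first exact: geodesic_upto_le gr.
  move=> i i_n; have [] := @HC (f \o s) m r (dist (f (s 0)) (f (s m))) _ _ gr r0 rl i.
  - by move=> k _ /=; apply: leq_trans (f_qi _ _).1 _; rewrite gs //; lia.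
  - by move=> k l kl _ /=; rewrite -(gs _ _ kl); exact: (f_qi _ _).2.
  - by lia.
  - by move=> j _ ij; exists j.
have [F HF] := choice seg.
have [|n|r [r0 gr rF]] := @geodesic_limit X (f (s 0)) F X_connected X_locally_finite.
- by move=> n; have [] := HF n.
- by have [] := HF n.
exists r; split=> // i; have [n [i_n <-//]] := rF i.
by have [_ _] := HF n; apply.
Qed.

(** Geodesics of [Z] from [z0] to the points of return have images near the geodesics of [X] with
    the same endpoints, and these fellow-travel [r]; [s] is a limit of them. The bound is free of
    [E], hence uniform over converging rays. *)
Lemma near_qi_ray : exists C, forall (z0 : Z) r, geodesic_ray r ->
  (exists E, forall N, exists n z, N <= n /\ dist (r n) (f z) <= E) ->
  exists s, [/\ geodesic_ray s, s 0 = z0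
    & forall i, exists j, dist (r i) (f (s j)) <= C + dist (r 0) (f z0)].
Proof.
have [D X4] := hyperbolic_four_point X_hyperbolic.
have [C HC] := morse X_connected X4 K; exists (C + 2 * D) => z0 r gr [E HE].
pose d0 := dist (r 0) (f z0); pose B := C + 2 * D + d0.
(* The bound on [j] keeps the partner of [r i] in the range where the limit agrees with a
   segment. *)
have seg n : exists s, [/\ s 0 = z0, geodesic_upto n s
    & forall i, i <= n -> exists j, j <= K * (d0 + i + B) /\ dist (r i) (f (s j)) <= B].
  have [m [z [nm rz]]] := HE (n + E + D + d0).+1.
  have [s [s0 sl gs]] := geodesic_segment Z_connected z0 z.
  have [q [q0 ql gq]] := geodesic_segment X_connected (f z0) (f z).
  have rq i : i <= n -> i <= dist (f z0) (f z) /\ dist (r i) (q i) <= d0 + 2 * D.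
    move=> i_n; rewrite /d0 -q0.
    apply: (fellow_travel X_connected X4 (n := m) (E := E)) => //.
    - exact: geodesic_ray_upto.
    - by rewrite q0.
    - by rewrite q0 ql.
    - by rewrite q0 -/d0; lia.
  exists s; split=> //.
    apply: geodesic_upto_le gs; apply: leq_trans (f_qi _ _).1.
    by have [] := rq n (leqnn _).
  move=> i i_n; have [il riqi] := rq i i_n.
  have [] := @HC (f \o s) (dist z0 z) q (dist (f z0) (f z)) _ _ gq _ _ i.
  - by move=> k kl /=; apply: leq_trans (f_qi _ _).1 _; rewrite gs //; lia.
  - by move=> k l kl lm /=; rewrite -(gs _ _ kl) //; exact: (f_qi _ _).2.
  - by rewrite /= s0.
  - by rewrite /= sl.
  - by lia.
  move=> j jl qisj; exists j.
  have le : dist (r i) (f (s j)) <= B.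
    by have := tri (q i) (r i) (f (s j)); move: qisj => /=; rewrite /B; lia.
  split=> //; have := gs 0 j (leq0n _) jl; rewrite subn0 => <-.
  apply: leq_trans (f_qi _ _).2 _; rewrite leq_mul2l; apply/orP; right.
  have := tri (r 0) (f (s 0)) (f (s j)); have := tri (r i) (r 0) (f (s j)).
  by rewrite (dsym (f (s 0)) (r 0)) gr // s0 -/d0; lia.
have [F HF] := choice seg.
have [|n|s [s0 gs sF]] := @geodesic_limit Z z0 F Z_connected Z_locally_finite.
- by move=> n; have [] := HF n.
- by have [] := HF n.
exists s; split=> // i; have [n [i_n nF]] := sF (i + K * (d0 + i + B)).
have [_ _ /(_ i)] := HF n; case; first by lia.
by move=> j [jB rij]; exists j; rewrite -nF //; lia.
Qed.

Lemma near_limit (R : nat -> nat -> X) (S : nat -> nat -> Z) r s C :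
  (forall n, geodesic_ray (R n)) -> (forall n, geodesic_ray (S n)) ->
  (forall n i, exists j, dist (R n i) (f (S n j)) <= C) ->
  (forall N, exists n, forall i, i <= N -> R n i = r i /\ S n i = s i) ->
  forall i, exists j, dist (r i) (f (s j)) <= C.
Proof.
move=> gR gS RS lim i; pose J := K * (dist (r 0) (f (s 0)) + i + C).
have [n Hn] := lim (i + J); have [j ij] := RS n i.
have [R0 S0] := Hn 0 (leq0n _).
have [Ri _] := Hn i (leq_addr _ _).
have jJ : j <= J.
  have := near_index_bound (gS n) _ ij; rewrite R0 S0; apply.
  by rewrite -R0 gR //; lia.
have [_ Sj] := Hn j (leq_trans jJ (leq_addl _ _)).
by exists j; rewrite -Sj -Ri.
Qed.

Lemma boundary_map_fhd xi eta r s : boundary_map f xi eta -> val xi r -> val eta s ->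
  finite_hausdorff_distance r (f \o s).
Proof.
move=> [r' [s' [xir' etas' r's']]] xir etas.
apply: fhd_trans (boundary_fhd X_connected xir xir') _ => //.
apply: fhd_trans r's' _ => //; apply: qi_fhd.
exact: (boundary_fhd Z_connected etas' etas).
Qed.

Lemma boundary_map_total eta : exists xi, boundary_map f xi eta.
Proof.
have [C HC] := qi_ray_near; have [s etas] := boundary_inhabited eta.
have gs := boundary_geodesic etas; have [r [gr _ rs]] := HC s gs.
have [xi xir] := boundary_class gr; exists xi, r, s; split=> //.
exact: near_fhd rs.
Qed.

Lemma boundary_map_fun xi xi' eta :
  boundary_map f xi eta -> boundary_map f xi' eta -> xi = xi'.
Proof.
move=> R R'; have [r xir] := boundary_inhabited xi.
have [r' xir'] := boundary_inhabited xi'; have [s etas] := boundary_inhabited eta.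
apply: (boundary_eq X_connected (r := r')) => //.
apply: (boundary_mem X_connected xir (boundary_geodesic xir')).
apply: fhd_trans (boundary_map_fhd R xir etas) _ => //.
exact/fhd_sym/(boundary_map_fhd R' xir' etas).
Qed.

Lemma boundary_map_inj xi eta eta' :
  boundary_map f xi eta -> boundary_map f xi eta' -> eta = eta'.
Proof.
move=> R R'; have [r xir] := boundary_inhabited xi.
have [s etas] := boundary_inhabited eta; have [s' etas'] := boundary_inhabited eta'.
apply: (boundary_eq Z_connected (r := s')) => //.
apply: (boundary_mem Z_connected etas (boundary_geodesic etas')).
apply: qi_fhd_inv; apply: fhd_trans (boundary_map_fhd R' xir etas') => //.
exact/fhd_sym/(boundary_map_fhd R xir etas).
Qed.

(** When [S n] converges to [s], the rays near [f \o S n] have a limit near [f \o s], which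
    represents [xi]; openness of [U] along that limit captures one of them. *)
Lemma boundary_map_inv_continuous : rel_continuous (fun eta xi => boundary_map f xi eta).
Proof.
move=> U oU; exists [set eta | exists2 xi, boundary_map f xi eta & U xi]; last first.
  move=> eta xi R; split=> [[xi' R' Uxi']|Uxi]; last by exists xi.
  by rewrite (boundary_map_fun R R').
have [C HC] := qi_ray_near.
apply: boundary_open_seq => eta s etas S [xi R Uxi] etasn etasS Ss.
have gS n : geodesic_ray (S n) := boundary_geodesic (etasS n).
have [F HF] := choice (fun n => HC (S n) (gS n)).
have [|n|r [r0 gr rF]] := @geodesic_limit X (f (s 0)) F X_connected X_locally_finite.
- by move=> n; have [_ ->] := HF n; rewrite Ss.
- by have [? _ _] := HF n; exact: geodesic_ray_upto.
have rs : forall i, exists j, dist (r i) (f (s j)) <= C.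
  apply: (near_limit (R := F) (S := S)) => //; try by move=> n; have [] := HF n.
  by move=> N; have [n [Nn nF]] := rF N; exists n => i iN; rewrite nF // Ss //; lia.
have xir : val xi r.
  have [r' xir'] := boundary_inhabited xi.
  apply: (boundary_mem X_connected xir' gr).
  apply: fhd_trans (boundary_map_fhd R xir' etasn) _ => //.
  by apply: fhd_sym => //; apply: near_fhd rs => //; exact: boundary_geodesic etasn.
have [N HN] := oU xi r Uxi xir; have [n [_ nF]] := rF N.
have [gF _ Fnear] := HF n; have [xin xinF] := boundary_class gF.
exists n, xin; last by apply: (HN _ _ xinF).
by exists (F n), (S n); split=> //; exact: near_fhd Fnear.
Qed.

(** One limit argument yields both continuity of the inverse on the image and, with [U] empty,
    closedness of the image. *)
Lemma boundary_map_open_or (U : set (gromov_boundary Z)) : open U ->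
  open [set xi | forall eta, boundary_map f xi eta -> U eta].
Proof.
move=> oU; have [C HC] := near_qi_ray.
apply: boundary_open_seq => xi r eta R Wxi xir etaR Rr; apply: contrapT => /forallNP nW.
have {}nW n : exists ze : gromov_boundary Z, boundary_map f (eta n) ze /\ ~ U ze.
  by have /existsNP[ze /not_implyP[]] := nW n; exists ze.
have [ze Hze] := choice nW.
have [s0 _] := boundary_inhabited (ze 0); pose z0 := s0 0.
have gR n : geodesic_ray (R n) := boundary_geodesic (etaR n).
have gr := boundary_geodesic xir.
have near n : exists s, [/\ geodesic_ray s, s 0 = z0
    & forall i, exists j, dist (R n i) (f (s j)) <= C + dist (r 0) (f z0)].
  have [s zes] := boundary_inhabited (ze n).
  have [E [Rs _]] := boundary_map_fhd (Hze n).1 (etaR n) zes.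
  rewrite -(Rr n 0) //; apply: HC => //; exists E => N.
  by have [j rj] := Rs N; exists N, (s j).
have [S HS] := choice near.
have [|n|s [sz0 gs sS]] := @geodesic_limit Z z0 S Z_connected Z_locally_finite.
- by move=> n; have [] := HS n.
- by have [? _ _] := HS n; exact: geodesic_ray_upto.
have rs : forall i, exists j, dist (r i) (f (s j)) <= C + dist (r 0) (f z0).
  apply: (near_limit (R := R) (S := S)) => //; try by move=> n; have [] := HS n.
  by move=> N; have [n [Nn nS]] := sS N; exists n => i iN; rewrite nS // Rr //; lia.
have [zeta zetas] := boundary_class gs.
have Uzeta : U zeta by apply: Wxi; exists r, s; split=> //; exact: near_fhd rs.
have [N HN] := oU zeta s Uzeta zetas; have [n [_ nS]] := sS N.
have [gS _ Snear] := HS n; apply: (Hze n).2.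
apply: (HN _ (S n)) => //; have [zn znS] := boundary_class gS.
rewrite (@boundary_map_inj (eta n) (ze n) zn) //; first exact: (Hze n).1.
by exists (R n), (S n); split=> //; exact: near_fhd Snear.
Qed.

Lemma boundary_map_continuous : rel_continuous (boundary_map f).
Proof.
move=> U /boundary_map_open_or oW; eexists; first exact: oW.
move=> xi eta R; split=> [|Ueta eta' R']; first exact.
by rewrite (boundary_map_inj R' R).
Qed.

Lemma boundary_map_image_closed : open [set xi | ~ exists eta, boundary_map f xi eta].
Proof.
have -> : [set xi | ~ exists eta, boundary_map f xi eta] =
    [set xi | forall eta, boundary_map f xi eta -> set0 eta].
  by apply/seteqP; split=> xi /= H; [move=> eta R; apply: H; exists eta|move=> [eta /H]].
exact/boundary_map_open_or/open0.
Qed.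

End QuasiIsometricEmbedding.

(** * Borel sets and hyperfiniteness *)

Section Borel.
Variable Y : topologicalType.
Implicit Types A B : set Y.

Lemma borel_open A : open A -> borel A.
Proof. exact: (@sub_sigma_algebra Y setT open). Qed.

Lemma borelC A : borel A -> borel (~` A).
Proof. by move=> bA; rewrite -setTD; exact: (@sigma_algebraCD Y setT open). Qed.

Lemma borel0 : borel (set0 : set Y).
Proof. exact: (@sigma_algebra0 Y setT open). Qed.

Lemma borel_bigcup (I : Type) (F : I -> set Y) : countable [set: I] ->
  (forall i, borel (F i)) -> borel (\bigcup_i F i).
Proof.
move=> /pcard_leTP [c] FB.
have -> : \bigcup_i F i = \bigcup_n (\bigcup_(i in [set i | c i = n]) F i).
  apply/seteqP; split=> [y [i _ Fy]|y [n _ [i _ Fy]]]; last by exists i.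
  by exists (c i) => //; exists i.
apply: (@sigma_algebra_bigcup Y setT open) => n.
have [[i cin]|none] := pselect (exists i, c i = n).
  rewrite (_ : \bigcup_(_ in _) _ = F i); first exact: FB.
  apply/seteqP; split=> [y [j /= cjn Fy]|y Fy]; last by exists i.
  by rewrite (_ : i = j) //; apply: (@inj _ _ _ c); rewrite ?inE // cin cjn.
rewrite (_ : \bigcup_(_ in _) _ = set0); first exact: borel0.
by apply/seteqP; split=> // y [i cin _]; apply: none; exists i.
Qed.

Lemma borelU A B : borel A -> borel B -> borel (A `|` B).
Proof.
move=> bA bB; rewrite (_ : _ `|` _ = \bigcup_b (if b then A else B)).
  by apply: borel_bigcup => [|[]] //; exact: countableP.
by apply/seteqP; split=> [y [Ay|By]|y [[] _ ?]];
  [exists true|exists false|left|right].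
Qed.

Lemma borelI A B : borel A -> borel B -> borel (A `&` B).
Proof.
move=> bA bB; rewrite -[A `&` B]setCK setCI.
by apply: borelC; apply: borelU; apply: borelC.
Qed.

Lemma borel_bigcap (I : Type) (F : I -> set Y) : countable [set: I] ->
  (forall i, borel (F i)) -> borel (\bigcap_i F i).
Proof.
move=> cI FB; rewrite -[\bigcap_i _]setCK setC_bigcap.
by apply: borelC; apply: borel_bigcup => // i; apply: borelC.
Qed.

Lemma borel_if (P : Prop) A : borel A -> borel [set y | P /\ A y].
Proof.
move=> bA; have [p|np] := pselect P.
  by rewrite (_ : [set _ | _] = A) //; apply/seteqP; split=> [y []|].
rewrite (_ : [set _ | _] = set0); first exact: borel0.
by apply/seteqP; split=> // y [].
Qed.

End Borel.

Lemma borel_preimage (Y Z : topologicalType) (f : Y -> Z) (B : set Z) :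
  continuous f -> borel B -> borel (f @^-1` B).
Proof.
move=> cf; move: B; apply: smallest_sub; last first.
  by move=> U oU; apply: borel_open; apply: open_comp.
split.
- by rewrite /= preimage_set0; exact: borel0.
- by move=> A bA /=; rewrite setTD preimage_setC; exact: borelC.
- by move=> F bF /=; rewrite preimage_bigcup; exact: borel_bigcup.
Qed.

Lemma borel_setX (Y Z : topologicalType) (A : set Y) (B : set Z) :
  borel A -> borel B -> @borel (Y * Z)%type [set p | A p.1 /\ B p.2].
Proof.
move=> bA bB; apply: borelI.
- by apply: (borel_preimage (f := fst)) => // p; exact: cvg_fst.
- by apply: (borel_preimage (f := snd)) => // p; exact: cvg_snd.
Qed.

Definition rel_dom (Y Z : Type) (R : Y -> Z -> Prop) : set Y := [set y | exists z, R y z].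

Definition rel_functional (Y Z : Type) (R : Y -> Z -> Prop) : Prop :=
  forall y z z', R y z -> R y z' -> z = z'.

(* As R and S are continuous and not merely Borel, the pullback of any open set of
   Z * Z is open in the product of their domains, even if the Borel sets of Z * Z
   are not generated by rectangles. *)
Lemma borel_pull (Y Z : topologicalType) (R S : Y -> Z -> Prop) (B : set (Z * Z)) :
  rel_functional R -> rel_functional S -> rel_continuous R -> rel_continuous S ->
  borel (rel_dom R) -> borel (rel_dom S) -> borel B ->
  @borel (Y * Y)%type [set p | exists z w, [/\ R p.1 z, S p.2 w & B (z, w)]].
Proof.
move=> funR funS cR cS dR dS; move: B; apply: smallest_sub; last first.
  move=> O oO /=.
  pose good (AB : set Y * set Y) := [/\ open AB.1, open AB.2
    & forall x y z w, AB.1 x -> AB.2 y -> R x z -> S y w -> O (z, w)].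
  rewrite (_ : [set _ | _] = (\bigcup_(AB in good) [set p : Y * Y | AB.1 p.1 /\ AB.2 p.2])
      `&` [set p | rel_dom R p.1 /\ rel_dom S p.2]).
    apply: borelI; last exact: borel_setX.
    apply: borel_open; apply: bigcup_open => -[A B] [oA oB _] /=.
    apply: openI.
    - by apply: (open_comp (f := fst)) => // p _; exact: cvg_fst.
    - by apply: (open_comp (f := snd)) => // p _; exact: cvg_snd.
  apply/seteqP; split=> -[x y] /=;
    [move=> [z [w [Rxz Syw Ozw]]]|
     move=> [[[A B] /= [_ _ AB] [Ax By]] [[z Rxz] [w Syw]]]].
    split; last by split; [exists z|exists w].
    have [[U V] [/= + +] UV] : nbhs (z, w) O by exact: open_nbhs_nbhs.
    rewrite !nbhsE => -[U' [oU' U'z] U'U] [V' [oV' V'w] V'V].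
    have [A oA AU] := cR _ oU'; have [B oB BV] := cS _ oV'.
    exists (A, B) => /=; last by split; [exact/(AU _ _ Rxz)|exact/(BV _ _ Syw)].
    split=> // x' y' z' w' Ax By Rx Sy; apply: (UV (z', w')); split=> /=.
    - by apply: U'U; exact/(AU _ _ Rx).
    - by apply: V'V; exact/(BV _ _ Sy).
  by exists z, w; split=> //; exact: AB Rxz Syw.
split.
- rewrite /= (_ : [set _ | _] = set0); first exact: borel0.
  by apply/seteqP; split=> // p [z [w []]].
- move=> A /= bA.
  rewrite (_ : [set p : Y * Y | exists z w, [/\ R p.1 z, S p.2 w & (setT `\` A) (z, w)]] =
     [set p | rel_dom R p.1 /\ rel_dom S p.2] `&`
     ~` [set p : Y * Y | exists z w, [/\ R p.1 z, S p.2 w & A (z, w)]]).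
    by apply: borelI; [exact: borel_setX|exact: borelC].
  apply/seteqP; split=> [[x y] /= [z [w [Rxz Syw [_ nA]]]]|[x y] /= [[[z Rxz] [w Syw]] nA]].
    split; first by split; [exists z|exists w].
    by move=> [z' [w' [/(funR _ _ _ Rxz) <- /(funS _ _ _ Syw) <-]]].
  by exists z, w; split=> //; split=> // Azw; apply: nA; exists z, w.
- move=> F /= bF.
  rewrite (_ : [set _ | _] = \bigcup_n [set p : Y * Y |
      exists z w, [/\ R p.1 z, S p.2 w & F n (z, w)]]).
    exact: borel_bigcup.
  apply/seteqP; split=> [[x y] /= [z [w [Rxz Syw [n _ Fn]]]]|[x y] /= [n _ [z [w [Rxz Syw Fn]]]]].
    by exists n => //; exists z, w.
  by exists z, w; split=> //; exists n.
Qed.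

(* Classes of the relation E on Y are coded, through countably many continuous
   partial injections R k i, by classes of relations on spaces Z k; for fixed k
   the domains indexed by i share a single target, so the combined map to Z k is
   only countable-to-one.  The n-th approximation uses the first n indices. *)
Lemma borel_hyperfinite_glue (Y : topologicalType) (E : Y -> Y -> Prop)
    (K I : Type) (Z : K -> topologicalType) (EZ : forall k, Z k -> Z k -> Prop)
    (R : forall k, I -> Y -> Z k -> Prop) :
  @borel (Y * Y)%type [set p | p.1 = p.2] ->
  countable [set: K] -> countable [set: I] ->
  (forall k, borel_hyperfinite (EZ k)) ->
  (forall k i, rel_functional (R k i)) ->
  (forall k i, rel_functional (fun z y => R k i y z)) ->
  (forall k i, rel_continuous (R k i)) ->
  (forall k i, borel (rel_dom (R k i))) ->
  (forall x, exists k i z, R k i x z) ->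
  (forall x k i z k' i' z', R k i x z -> R k' i' x z' -> k = k' /\ i = i') ->
  (forall x y k i z k' i' z', R k i x z -> R k' i' y z' -> E x y -> k = k') ->
  (forall x y k i z j w, R k i x z -> R k j y w -> (E x y <-> EZ k z w)) ->
  borel_hyperfinite E.
Proof.
move=> bdiag cntK cI hfZ funR injR contR domR cover disj inv ER.
have /pcard_leTP [c] := cI; have /pcard_leTP [cK] := cntK.
pose F k := projT1 (cid (hfZ k)); 
have HF k : [/\ forall n, finite_borel_equivalence (F k n),
    forall n x y, F k n x y -> F k n.+1 x y
  & forall x y, EZ k x y <-> exists n, F k n x y] := projT2 (cid (hfZ k)).
have FK k n : finite_borel_equivalence (F k n) by have [? _ _] := HF k.
have Fmono k m n z w : m <= n -> F k m z w -> F k n z w.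
  move=> /subnK <-; elim: (n - m) => //= p IH Fm; rewrite addSn.
  by have [_ mono _] := HF k; apply: mono; exact: IH.
exists (fun n x y => x = y \/ exists k i j, [/\ (cK k <= n), (c i <= n), (c j <= n)
  & exists z w, [/\ R k i x z, R k j y w & F k n z w]]); split.
- move=> n; split.
  + split=> [x|x y [->|[k [i [j [kn i_n jn [z [w [Rx Ry Fzw]]]]]]]]|x y t].
    * by left.
    * by left.
    * right; exists k, j, i; split=> //; exists w, z; split=> //.
      by have [[_ symF _] _ _] := FK k n; exact: symF.
    * move=> [->//|[k [i [j [kn i_n jn [z [w [Rx Ry Fzw]]]]]]]] [<-|].
        by right; exists k, i, j; split=> //; exists z, w.
      move=> [k' [i' [j' [kn' i_n' jn' [z' [w' [Ry' Rt Fzw']]]]]]].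
      have [kk ii] := disj _ _ _ _ _ _ _ Ry Ry'; subst k' i'.
      rewrite -(funR _ _ _ _ _ Ry Ry') in Fzw'.
      right; exists k, i, j'; split=> //; exists z, w'; split=> //.
      by have [[_ _ trF] _ _] := FK k n; exact: trF Fzw Fzw'.
  + rewrite (_ : [set _ | _] = [set p : Y * Y | p.1 = p.2] `|` \bigcup_k \bigcup_i \bigcup_j
       [set p : Y * Y | [/\ cK k <= n, c i <= n & c j <= n] /\
         [set p : Y * Y | exists z w,
           [/\ R k i p.1 z, R k j p.2 w & [set q | F k n q.1 q.2] (z, w)]] p]).
      apply: borelU => //; apply: borel_bigcup => // k.
      apply: borel_bigcup => // i; apply: borel_bigcup => // j; apply: borel_if.
      by apply: borel_pull => //; have [] := FK k n.
    apply/seteqP; split=> [[x y] /= [->|[k [i [j [kn i_n jn Fxy]]]]]|[x y] /= [->|]].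
    * by left.
    * by right; exists k => //; exists i => //; exists j.
    * by left.
    * by move=> [k _ [i _ [j _ [[kn i_n jn] Fxy]]]]; right; exists k, i, j.
  + move=> x; have [k [i [z Rx]]] := cover x.
    apply: (@sub_finite_set _ _ ([set x] `|` \bigcup_(j in [set j | c j <= n])
        \bigcup_(w in [set w | F k n z w]) [set y | R k j y w])).
      move=> y /= [->|[k' [i' [j [_ _ jn [z' [w [Rx' Ry Fzw]]]]]]]]; [by left|right].
      have [kk ii] := disj _ _ _ _ _ _ _ Rx Rx'; subst k' i'.
      by exists j => //; exists w => //=; rewrite (funR _ _ _ _ _ Rx Rx').
    rewrite finite_setU; split; first exact: finite_set1.
    apply: bigcup_finite => [|j _].
      apply: (finite_preimage (f := c) (B := [set m | m <= n])).
        by move=> a b _ _; apply: inj; rewrite inE.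
      by apply: (sub_finite_set _ (finite_II n.+1)) => m /=; rewrite ltnS.
    apply: bigcup_finite => [|w _]; first by have [_ _] := FK k n; apply.
    have [[y Ry]|none] := pselect (exists y, R k j y w).
      apply: (sub_finite_set _ (finite_set1 y)) => y' /= Ry'.
      exact: injR Ry' Ry.
    by apply: (sub_finite_set _ (finite_set0 _)) => y Ry; apply: none; exists y.
- move=> n x y [->|[k [i [j [kn i_n jn [z [w [Rx Ry Fzw]]]]]]]]; [by left|right].
  exists k, i, j; split; try exact: leqW; exists z, w; split=> //.
  exact: Fmono Fzw.
- move=> x y; have [k [i [z Rx]]] := cover x; split=> [Exy|[n [<-|]]].
  + have [k' [j [w Ry]]] := cover y; have kk := inv _ _ _ _ _ _ _ _ Rx Ry Exy; subst k'.
    have [_ _ HE] := HF k; have /HE [m Fm] := (ER _ _ _ _ _ _ _ Rx Ry).1 Exy.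
    exists (m + cK k + c i + c j); right; exists k, i, j; split; try lia.
    by exists z, w; split=> //; apply: Fmono Fm; lia.
  + apply: (ER _ _ _ _ _ _ _ Rx Rx).2; have [_ _ HE] := HF k.
    by apply/HE; exists 0; have [[reflF _ _] _ _] := FK k 0.
  + move=> [k' [i' [j [_ _ _ [z' [w [Rx' Ry Fzw]]]]]]].
    apply: (ER _ _ _ _ _ _ _ Rx' Ry).2; have [_ _ HE] := HF k'.
    by apply/HE; exists n.
Qed.

Lemma borel_diagonal_pull (Y Z : topologicalType) (R : Y -> Z -> Prop) :
  rel_functional R -> rel_functional (fun z y => R y z) -> rel_continuous R ->
  (forall y, exists z, R y z) -> @borel (Z * Z)%type [set p | p.1 = p.2] ->
  @borel (Y * Y)%type [set p | p.1 = p.2].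
Proof.
move=> funR injR cR tot bZ.
rewrite (_ : [set p : Y * Y | p.1 = p.2] =
  [set p : Y * Y | exists z w, [/\ R p.1 z, R p.2 w & [set q | q.1 = q.2] (z, w)]]).
  have bT : borel (rel_dom R).
    rewrite (_ : rel_dom R = setT); first by apply: borel_open; exact: openT.
    by apply/seteqP; split=> // y _; exact: tot.
  exact: (borel_pull (B := [set q | q.1 = q.2])).
apply/seteqP; split=> [[x y] /= <-|[x y] /= [z [w [Rx Ry zw]]]].
  by have [z Rx] := tot x; exists z, z.
by rewrite -zw in Ry; exact: injR Rx Ry.
Qed.

(** Gluing with a single piece; this carries hyperfiniteness from the boundary of [X] to bags and to
    the ends of [T]. *)
Lemma borel_hyperfinite_pull (Y Z : topologicalType) (E : Y -> Y -> Prop)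
    (EZ : Z -> Z -> Prop) (R : Y -> Z -> Prop) :
  @borel (Z * Z)%type [set p | p.1 = p.2] ->
  rel_functional R -> rel_functional (fun z y => R y z) -> rel_continuous R ->
  (forall y, exists z, R y z) ->
  (forall x y z w, R x z -> R y w -> (E x y <-> EZ z w)) ->
  borel_hyperfinite EZ -> borel_hyperfinite E.
Proof.
move=> bZ funR injR cR tot ER hfZ.
have cu : countable [set: unit] by exact: countableP.
apply: (@borel_hyperfinite_glue Y E unit unit (fun _ => Z) (fun _ => EZ)
  (fun _ _ => R)) => //.
- exact: borel_diagonal_pull funR injR cR tot bZ.
- move=> _ _; rewrite (_ : rel_dom R = setT); first by apply: borel_open; exact: openT.
  by apply/seteqP; split=> // y _; exact: tot.
- by move=> x [] [] z [] [].
- by move=> x y [] ? ? [].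
- by move=> x y _ _ z _ w; exact: ER.
Qed.

(** * The diagonal of the boundary is a Borel set *)

Section BoundaryDiagonal.
Variable X : graph.
Hypothesis X_connected : graph_connected X.
Hypothesis X_locally_finite : locally_finite X.
Hypothesis X_hyperbolic : hyperbolic X.

Lemma ray_from (xi : gromov_boundary X) (x0 : X) : exists2 r, val xi r & r 0 = x0.
Proof.
have qi : qi_embedding 1 (@id X) by move=> a b; rewrite mul1n.
have [C HC] := near_qi_ray X_connected X_hyperbolic X_connected X_locally_finite qi.
have [r xir] := boundary_inhabited xi; have gr := boundary_geodesic xir.
have [|s [gs s0 rs]] := HC x0 r gr.
  by exists 0 => N; exists N, (r N); rewrite distxx.
exists s => //; apply: (boundary_mem X_connected xir gs).
exact: (near_fhd X_connected qi gr gs rs).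
Qed.

(** The shadow of [p] seen from [x0]. Shadows are closed, countably many for a given [x0], and
    separate points. *)
Definition boundary_through (x0 p : X) : set (gromov_boundary X) :=
  [set xi | exists r, [/\ val xi r, r 0 = x0 & exists n, r n = p]].

(** A geodesic ray from [x0] can meet [p] only at time [dist x0 p], so limits of rays through [p]
    still pass through [p]; fellow travelling keeps the limit in the class [xi]. *)
Lemma boundary_through_closed x0 p : open (~` boundary_through x0 p).
Proof.
have [D X4] := hyperbolic_four_point X_hyperbolic.
apply: boundary_open_seq => xi r eta s nxi xir etas sr; apply: contrapT => /forallNP H.
have {}H n : exists t, [/\ val (eta n) t, t 0 = x0 & exists n, t n = p].
  by apply: contrapT; exact: H.
have [F HF] := choice H.
have gF n : geodesic_ray (F n) by have [/boundary_geodesic] := HF n.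
have [|n|t [t0 gt tF]] := @geodesic_limit X x0 F X_connected X_locally_finite.
- by move=> n; have [] := HF n.
- exact: geodesic_ray_upto.
apply: nxi; exists t; split=> //; last first.
  have [n [n_p nF]] := tF (dist x0 p); have [_ F0 [m Fm]] := HF n.
  by exists m; rewrite -nF // -Fm -F0 gF // subn0.
apply: (boundary_mem X_connected xir gt).
apply: (@fhd_pointwise X _ _ (dist (r 0) x0 + 2 * D)) => i.
have [n [i_n nF]] := tF i; have [etaF F0 _] := HF n.
rewrite -(nF i) // -(sr n i) // -(sr n 0) // -F0.
apply: fhd_fellow_travel => //; first exact: boundary_geodesic (etas n).
exact: boundary_fhd (etas n) etaF.
Qed.

(** Each vertex [r n] of a ray of [xi] from [x0] is met, necessarily at time [n], by a ray of [eta]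
    from [x0]. That ray varies with [n], but rays of one class from one vertex stay within [2 * D]
    of each other. *)
Lemma boundary_through_separates x0 xi eta :
  (forall p, boundary_through x0 p xi <-> boundary_through x0 p eta) -> xi = eta.
Proof.
have [D X4] := hyperbolic_four_point X_hyperbolic => sep.
have [r xir r0] := ray_from xi x0; have gr := boundary_geodesic xir.
have H n : exists s, [/\ val eta s, s 0 = x0 & s n = r n].
  have [|s [etas s0 [m smn]]] := (sep (r n)).1; first by exists r; split=> //; exists n.
  exists s; split=> //; rewrite -smn; congr s.
  have := gr 0 n (leq0n _); rewrite -smn r0 -s0 (boundary_geodesic etas) // !subn0.
  by move->.
have [s0 [etas0 s00 _]] := H 0.
apply: (boundary_eq X_connected (r := s0)) => //.
apply: (boundary_mem X_connected xir); first exact: boundary_geodesic etas0.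
apply: (@fhd_pointwise X _ _ (2 * D)) => i.
have [s [etas s0x <-]] := H i.
have := fhd_fellow_travel X_connected X4 (boundary_geodesic etas) (boundary_geodesic etas0)
  (boundary_fhd X_connected etas etas0) i.
by rewrite s0x s00 distxx.
Qed.

Lemma borel_boundary_diagonal :
  @borel (gromov_boundary X * gromov_boundary X)%type [set p | p.1 = p.2].
Proof.
have [[x0]|nX] := pselect (inhabited X); last first.
  rewrite (_ : [set _ | _] = set0); first exact: borel0.
  apply/seteqP; split=> // -[xi eta] _; have [r _] := boundary_inhabited xi.
  by apply: nX; exact: (inhabits (r 0)).
pose C := boundary_through x0.
have bC p : borel (C p).
  by rewrite -[C p]setCK; apply: borelC; apply: borel_open; exact: boundary_through_closed.
rewrite (_ : [set _ | _] = \bigcap_p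
  ([set q | C p q.1 /\ C p q.2] `|` [set q | (~` C p) q.1 /\ (~` C p) q.2])).
  apply: borel_bigcap => [|p]; first exact: countable_graph.
  by apply: borelU; apply: borel_setX => //; exact: borelC.
apply/seteqP; split=> [[xi eta] /= <- p _|[xi eta] /= H].
  by have [?|?] := pselect (C p xi); [left|right].
apply: (@boundary_through_separates x0) => p.
by have [[? ?]|[? ?]] := H p I; split.
Qed.

End BoundaryDiagonal.

(** * Ends, automorphisms and trees *)

Section Components.
Variable X : graph.
Implicit Types (S C : set X) (x y : X).

Lemma component_at S x : ~ S x -> exists2 C, components_minus S C & C x.
Proof.
move=> Sx; have xS : x \in ~` S by rewrite inE.
pose a : induced (~` S) := exist _ x xS.
exists (@incl _ (~` S) @` [set b | reachable a b]); first by exists a.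
by exists a => //; exact: reachable_refl.
Qed.

Lemma component_subC S C : components_minus S C -> C `<=` ~` S.
Proof. by move=> [a _ <-] _ [b _ <-]; have := set_mem (valP (b : set_type _)). Qed.

Lemma component_adj S C x y : components_minus S C -> adj x y -> ~ S y -> C x -> C y.
Proof.
move=> [a _ <-] xy Sy [b ab bx]; have yS : y \in ~` S by rewrite inE.
pose c : induced (~` S) := exist _ y yS.
exists c => //; apply: reachable_trans ab _; apply: adj_reachable.
by rewrite /= /induced_adj -[val b]/(incl b) bx.
Qed.

Lemma component_ind S C (P : X -> Prop) x y : components_minus S C -> C x -> C y ->
  (forall z w, ~ S z -> ~ S w -> adj z w -> P z -> P w) -> P x -> P y.
Proof.
move=> [a _ <-] [b ab <-] [c ac <-] step Pb.
have [n [p [pp <- _]]] := reachable_trans (reachable_sym ab) ac.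
elim: p b {ab} pp Pb => //= d p IH b /andP[bd pp] Pb; apply: IH => //.
apply: step Pb => //.
- exact: (set_mem (valP (b : set_type _))).
- exact: (set_mem (valP (d : set_type _))).
Qed.

Lemma end_equiv_sym (r s : nat -> X) : end_equiv r s -> end_equiv s r.
Proof. by move=> rs S /rs [C [cC rC sC]]; exists C. Qed.

Lemma end_equiv_trans (r s t : nat -> X) : end_equiv r s -> end_equiv s t -> end_equiv r t.
Proof.
move=> rs st S fS; have [C [cC rC sC]] := rs S fS; have [C' [cC' sC' tC']] := st S fS.
have [x [Cx C'x]] := has_tail_in_meet sC sC'.
exists C; split=> //; have [n tn] := tC'; exists n => i /tn.
exact: (sub_component (@subset_refl _ S) cC cC' Cx C'x).
Qed.

Implicit Types (omega : end_space X).

Lemma endE omega : exists2 r, ray r & val omega = [set s | ray s /\ end_equiv r s].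
Proof. by have [r gr <-] := set_mem (valP (omega : set_type _)); exists r. Qed.

Lemma end_inhabited omega : exists r, val omega r.
Proof. by have [r gr ->] := endE omega; exists r; split=> //; exact: ray_end_equiv. Qed.

Lemma end_ray omega r : val omega r -> ray r.
Proof. by have [s _ ->] := endE omega => -[]. Qed.

Lemma end_rel omega r s : val omega r -> val omega s -> end_equiv r s.
Proof.
have [t _ ->] := endE omega => -[_ tr] [_ ts].
by apply: end_equiv_trans ts; exact: end_equiv_sym.
Qed.

Lemma end_mem omega r s : val omega r -> ray s -> end_equiv r s -> val omega s.
Proof.
have [t _ ->] := endE omega => -[_ tr] rs_ rs; split=> //.
exact: end_equiv_trans tr rs.
Qed.

Lemma end_eq omega omega' r : val omega r -> val omega' r -> omega = omega'.
Proof.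
move=> or o'r; apply: val_inj; apply/seteqP; split=> s os.
- exact: end_mem o'r (end_ray os) (end_rel or os).
- exact: end_mem or (end_ray os) (end_rel o'r os).
Qed.

Lemma end_class r : ray r -> exists omega, val omega r.
Proof.
move=> rr; pose C := [set s | ray s /\ end_equiv r s].
have CX : C \in @ends X by rewrite inE; exists r.
by exists (exist _ C CX); split=> //; exact: ray_end_equiv.
Qed.

End Components.

Section Automorphisms.
Variable X : graph.
Hypothesis X_connected : graph_connected X.
Implicit Types (g h : X -> X) (r s : nat -> X).

Lemma automorphism_inv g : automorphism g ->
  exists h, [/\ automorphism h, cancel g h & cancel h g].
Proof.
move=> [[h gh hg] gadj]; exists h; split=> //; split; first by exists g.
by move=> x y; rewrite -gadj !hg.
Qed.

Lemma automorphism_dist g x y : automorphism g -> dist (g x) (g y) = dist x y.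
Proof.
have le h a b : automorphism h -> dist (h a) (h b) <= dist a b.
  move=> [_ hadj]; apply: dist_le.
  have [p [pp <- sp]] := dist_walk (X_connected a b).
  exists (map h p); rewrite last_map size_map sp; split=> //.
  by rewrite path_map (eq_path (e' := @adj X)).
move=> ag; apply/eqP; rewrite eqn_leq le //=.
by have [h [ah gh hg]] := automorphism_inv ag; rewrite -{1}(gh x) -{1}(gh y) le.
Qed.

Lemma automorphism_geodesic_ray g r : automorphism g -> geodesic_ray r ->
  geodesic_ray (g \o r).
Proof. by move=> ag gr i j ij; rewrite /= automorphism_dist // gr. Qed.

Lemma automorphism_fhd g r s : automorphism g ->
  finite_hausdorff_distance (g \o r) (g \o s) <-> finite_hausdorff_distance r s.
Proof.
by move=> ag; split=> -[C [rs sr]]; exists C; split=> i;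
  [have [j Hj] := rs i|have [j Hj] := sr i|have [j Hj] := rs i|have [j Hj] := sr i];
  exists j; move: Hj; rewrite /= automorphism_dist.
Qed.

Lemma boundary_orbitP (G : set (X -> X)) (xi eta : gromov_boundary X) :
  G `<=` @automorphism X ->
  boundary_orbit G xi eta <->
  exists g r, [/\ G g, val xi r & val eta (g \o r)].
Proof.
move=> GA; split=> [[g Gg E]|[g [r [Gg xir etagr]]]].
  have [r xir] := boundary_inhabited xi.
  by exists g, r; split=> //; rewrite E; exists r.
have ag := GA g Gg; exists g => //; apply/seteqP; split=> [s etas|_ [s xis <-]].
  have [h [ah gh hg]] := automorphism_inv ag.
  have E : g \o (h \o s) = s by apply/funext => i /=; rewrite hg.
  exists (h \o s) => //; apply: (boundary_mem X_connected xir).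
    exact/automorphism_geodesic_ray/(boundary_geodesic etas).
  by apply/(automorphism_fhd _ _ ag); rewrite E; exact: boundary_fhd etas.
apply: (boundary_mem X_connected etagr).
  exact/automorphism_geodesic_ray/(boundary_geodesic xis).
by apply/(automorphism_fhd _ _ ag); exact: boundary_fhd xis.
Qed.

End Automorphisms.

(** * Halves of a tree, geodesics and ends *)

Section Trees.
Variable T : graph.
Hypothesis T_tree : is_tree T.
Implicit Types (s t u v x y : T) (tau : nat -> T).
Let T_connected : graph_connected T := T_tree.1.
Local Notation tri := (dist_triangle T_connected).
Local Notation dsym := (dist_sym T_connected).

Lemma walk_avoiding s t x : dist x s <= dist t s -> x != t ->
  exists p, [/\ path (@adj T) x p, last x p = s & t \notin x :: p].
Proof.
move=> xt nxt; have [p [pp ps szp]] := dist_walk (T_connected x s).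
exists p; split=> //; apply/negP => tp.
case/splitPl : tp pp ps szp nxt xt => p1 p2 p1t.
rewrite cat_path last_cat p1t size_cat => /andP[_ pp2] p2s szp nxt xt.
have : dist t s <= size p2 by apply: dist_le; exists p2.
case: p1 p1t szp => [/= xE|a p1 _ /=]; last by lia.
by rewrite xE eqxx in nxt.
Qed.

(** The place where acyclicity enters: two distinct such neighbours are joined by a walk avoiding
    [t], and the path extracted from it closes up through [t] to a cycle. The weak inequalities also
    exclude ties, as [half_total] needs. *)
Lemma tree_parent_unique s t u u' : adj t u -> adj t u' ->
  dist u s <= dist t s -> dist u' s <= dist t s -> u = u'.
Proof.
move=> tu tu' us u's; apply/eqP; apply/negPn/negP => uu'.
have nut : u != t by apply/eqP => E; rewrite E adj_irrefl in tu.
have nu't : u' != t by apply/eqP => E; rewrite E adj_irrefl in tu'.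
have [p [pp ps tp]] := walk_avoiding us nut.
have [q [pq qs tq]] := walk_avoiding u's nu't.
have [w [pw wu' tw]] : exists w, [/\ path (@adj T) u w, last u w = u' & t \notin u :: w].
  exists (p ++ rev (belast u' q)); split.
  - rewrite cat_path pp ps -qs rev_path (eq_path (e' := @adj T)) // => ? ?.
    exact: adj_sym.
  - rewrite last_cat ps; case: q {pq tq} qs => //= a q _.
    by rewrite rev_cons last_rcons.
  - rewrite -cat_cons mem_cat negb_or tp mem_rev /=; apply: contra tq.
    exact: mem_belast.
case: (shortenP pw) wu' tw => z pz uz zw zu' tw.
have tz : t \notin u :: z.
  move: tw; rewrite !inE !negb_or => /andP[-> /=].
  by apply: contra; exact: zw.
have [_ /(_ (t :: u :: z))] := T_tree; apply.
  by case: z zu' {pz uz zw tz} => [/= E|//]; rewrite E eqxx in uu'.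
split; last by rewrite cons_uniq tz.
by rewrite /cycle rcons_cons /= tu rcons_path pz zu' adj_sym tu'.
Qed.

Lemma tree_parent s x : x != s -> exists2 p, adj x p & dist p s < dist x s.
Proof.
move=> xs; have [r [r0 rn gr]] := geodesic_segment T_connected x s.
have n0 : 0 < dist x s.
  rewrite lt0n; apply: contra xs => /eqP /(dist_eq0 T_connected) ->; exact: eqxx.
exists (r 1); first by rewrite -{1}r0; exact: (geodesic_adj T_connected gr).
by rewrite -{1}rn gr //; lia.
Qed.

(** For an edge [uv], the component of [T] minus that edge containing [u]; in terms of distances its
    invariance under automorphisms is immediate. *)
Definition half u v : set T := [set s | dist s u < dist s v].

Lemma half_self u v : adj u v -> half u v u.
Proof. by move=> uv; rewrite /half /= distxx (adj_dist T_connected uv). Qed.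

Lemma half_total u v s : adj u v -> half u v s \/ half v u s.
Proof.
move=> uv; rewrite /half /=; have [|lt|E] := ltngtP (dist s u) (dist s v); [by left|by right|].
have us : u != s.
  apply: contraL (uv) => /eqP us; have := E; rewrite us distxx => /esym /(dist_eq0 T_connected) ->.
  by rewrite adj_irrefl.
have [p up ps] := tree_parent us.
have pv : p = v by apply: (tree_parent_unique up uv (ltnW ps)); rewrite (dsym v) (dsym u) E.
by move: ps; rewrite pv (dsym v) (dsym u) E ltnn.
Qed.

Lemma half_asym u v s : half u v s -> ~ half v u s.
Proof. by rewrite /half /=; lia. Qed.

(** Unless [s = u], both [s'] and the neighbour of [s] closer to [u] are no farther from [v] than
    [s], so they coincide by [tree_parent_unique]; this contradicts the sides of [s] and [s']. *)
Lemma half_cross u v s s' : adj u v -> adj s s' -> half u v s -> half v u s' ->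
  s = u /\ s' = v.
Proof.
move=> uv ss'; rewrite /half /= => su s'v.
have duv := adj_dist T_connected uv; have dss' := adj_dist T_connected ss'.
have [E|su0] : dist s u = 0 \/ 0 < dist s u by lia.
  have su0 := dist_eq0 T_connected E; split=> //; rewrite dsym su0 in dss'.
  by apply: (dist_eq0 T_connected); lia.
exfalso; have : s != u by apply/eqP => E; rewrite E distxx in su0.
move=> /tree_parent [p sp pu].
have t1 := tri s s' u; have t2 := tri s' s v; have t3 := tri u p v; have t4 := tri u s v.
have t5 := tri v s' u.
rewrite (dsym s' s) in t1; rewrite (dsym v u) in t5.
have ps' : p = s' by apply: (tree_parent_unique (s := v) sp ss'); lia.
by subst p; lia.
Qed.

Lemma half_ind u v (P : T -> Prop) : adj u v -> P u ->
  (forall y p, half u v y -> half u v p -> adj y p -> P p -> P y) ->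
  forall y, half u v y -> P y.
Proof.
move=> uv Pu step y; have [n] := ubnP (dist y u); elim: n y => // n IH y yn hy.
have [->//|yu] := eqVneq y u; have [p yp pu] := tree_parent yu.
have hp : half u v p.
  have [//|hp] := half_total p uv.
  by have [E _] := half_cross uv yp hy hp; rewrite E eqxx in yu.
by apply: (step _ _ hy hp yp); apply: IH => //; lia.
Qed.

(** [half a b] is connected and misses [v], so it cannot cross the edge [uv] and stays on the side
    of [x]. *)
Lemma half_nested a b u v x : adj a b -> adj u v -> half a b x -> half u v x ->
  ~ half a b v -> half a b `<=` half u v.
Proof.
move=> ab uv abx uvx abv.
have step y p : half a b y -> half a b p -> adj y p -> half u v y -> half u v p.
  move=> _ abp yp uvy; have [//|vup] := half_total p uv.
  by have [_ E] := half_cross uv yp uvy vup; rewrite E in abp.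
have H y : half a b y -> (half u v y <-> half u v a).
  apply: (half_ind (P := fun y => half u v y <-> half u v a)) => // z p abz abp zp <-.
  by split; apply: step; rewrite // adj_sym.
by move=> y aby; apply/(H y aby)/(H x abx).
Qed.

Lemma half_sub_component S C u v x : components_minus S C -> adj u v ->
  (forall y, half u v y -> ~ S y) -> C x -> half u v x -> half u v `<=` C.
Proof.
move=> cC uv hS Cx hx.
have H y : half u v y -> (C y <-> C u).
  apply: (half_ind (P := fun y => C y <-> C u)) => // z p hz hp zp <-.
  by split; apply: component_adj cC _ _; rewrite ?(adj_sym p z) //; exact: hS.
by move=> y hy; apply/(H y hy)/(H x hx).
Qed.

Lemma component_sub_half S C u v x : components_minus S C -> adj u v -> S v ->
  C x -> half u v x -> C `<=` half u v.
Proof.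
move=> cC uv Sv Cx hx y Cy; apply: (component_ind cC Cx Cy) hx => z w _ Sw zw hz.
have [//|hw] := half_total w uv.
by have [_ E] := half_cross uv zw hz hw; rewrite E in Sw.
Qed.

(** If the distance to the start failed to grow, [tau k.+2] and [tau k] would coincide by
    [tree_parent_unique]. *)
Lemma nonbacktracking_geodesic tau : (forall k, adj (tau k) (tau k.+1)) ->
  (forall k, tau k.+2 <> tau k) -> geodesic_ray tau.
Proof.
move=> adjt nb.
have H m k : dist (tau (m + k)) (tau m) = k /\ dist (tau (m + k).+1) (tau m) = k.+1.
  elim: k => [|k [IH1 IH2]].
    by rewrite addn0 distxx dsym (adj_dist T_connected (adjt m)).
  rewrite addnS; split=> //; apply/eqP; rewrite eqn_leq; apply/andP; split.
    have := tri (tau (m + k).+1) (tau (m + k).+2) (tau m).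
    by rewrite (dsym (tau (m + k).+2) (tau (m + k).+1)) (adj_dist T_connected (adjt _)); lia.
  rewrite ltnNge; apply/negP => le; apply: (nb (m + k)).
  apply: (tree_parent_unique (s := tau m) (t := tau (m + k).+1)) => //; try lia.
  by rewrite adj_sym.
by move=> i j ij; rewrite dsym -(H i (j - i)).1 subnKC.
Qed.

Lemma tree_ray_geodesic tau : ray tau -> geodesic_ray tau.
Proof.
move=> [inj adjt]; apply: nonbacktracking_geodesic => // k /inj; lia.
Qed.

(** These decreasing halves act as a neighbourhood base at the end of a ray [tau], even at infinite
    degree, since they eventually avoid every finite set. *)
Definition ahead tau k : set T := half (tau k.+1) (tau k).

Lemma ray_adj tau k : ray tau -> adj (tau k.+1) (tau k).
Proof. by move=> [_ adjt]; rewrite adj_sym. Qed.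

Lemma aheadS tau k : ray tau -> ahead tau k.+1 `<=` ahead tau k.
Proof.
move=> rt; have gt := tree_ray_geodesic rt.
apply: (half_nested (x := tau k.+2)); try exact: ray_adj.
- exact/half_self/ray_adj.
- by rewrite /half /= !(geodesic_dist T_connected) //; lia.
- by rewrite /half /= !(geodesic_dist T_connected) //; lia.
Qed.

Lemma ahead_mono tau k m : ray tau -> k <= m -> ahead tau m `<=` ahead tau k.
Proof.
move=> rt /subnK <-; elim: (m - k) => //= n IH.
by rewrite addSn; exact: subset_trans (aheadS rt) IH.
Qed.

Lemma ahead_tail tau k i : ray tau -> k < i -> ahead tau k (tau i).
Proof.
move=> rt ki; have gt := tree_ray_geodesic rt.
by rewrite /ahead /half /= !(geodesic_dist T_connected) //; lia.
Qed.

Lemma ahead_bound tau k v : ray tau -> ahead tau k v -> k < dist v (tau 0).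
Proof.
move=> rt; suff H : ahead tau k v -> dist v (tau k.+1) + k.+1 <= dist v (tau 0).
  by move=> /H; lia.
elim: k => [|k IH] h; first by move: h; rewrite /ahead /half /=; lia.
by have := IH (aheadS rt h); move: h; rewrite /ahead /half /=; lia.
Qed.

Lemma ahead_avoid tau (S : set T) : ray tau -> finite_set S ->
  exists k, forall x, ahead tau k x -> ~ S x.
Proof.
move=> rt /(finite_set_dist_bound (tau 0)) [M HM]; exists M => x /(ahead_bound rt) lt /HM.
by rewrite dsym; lia.
Qed.

Lemma end_equiv_ahead tau tau' k : ray tau -> end_equiv tau tau' ->
  has_tail_in (ahead tau k) tau'.
Proof.
move=> rt /(_ [set tau k] (finite_set1 _)) [C [cC [n nC] [m mC]]].
exists m => i /mC; apply: (component_sub_half cC) => //; first exact: ray_adj.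
- by apply: (nC (n + k).+1); lia.
- by apply: ahead_tail => //; lia.
Qed.

Lemma ahead_meet_end_equiv tau tau' : ray tau -> ray tau' ->
  (forall k m, exists x, ahead tau k x /\ ahead tau' m x) -> end_equiv tau tau'.
Proof.
move=> rt rt' meet S fS; have [k kS] := ahead_avoid rt fS.
have [m mS] := ahead_avoid rt' fS; have [x [kx mx]] := meet k m.
have [C cC Cx] := component_at (kS x kx); exists C; split=> //.
- exists k.+1 => i ki; apply: (half_sub_component cC (ray_adj k rt) kS Cx kx).
  exact: ahead_tail.
- exists m.+1 => i mi; apply: (half_sub_component cC (ray_adj m rt') mS Cx mx).
  exact: ahead_tail.
Qed.

Lemma end_equivP tau tau' : ray tau -> ray tau' ->
  end_equiv tau tau' <-> forall k, has_tail_in (ahead tau k) tau'.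
Proof.
move=> rt rt'; split=> [equiv k|H]; first exact: end_equiv_ahead.
apply: ahead_meet_end_equiv => // k m; have [n Hn] := H k.
by exists (tau' (n + m).+1); split; [apply: Hn; lia|apply: ahead_tail => //; lia].
Qed.

Lemma automorphism_ray g tau : automorphism g -> ray tau -> ray (g \o tau).
Proof.
move=> [bg adjg] [inj adjt]; split=> [i j /= /(bij_inj bg) /inj //|i /=].
by rewrite adjg.
Qed.

Lemma automorphism_end_equiv g tau tau' : automorphism g -> ray tau -> ray tau' ->
  end_equiv tau tau' -> end_equiv (g \o tau) (g \o tau').
Proof.
move=> ag rt rt' /(end_equivP rt rt') H.
apply/end_equivP; try exact: automorphism_ray.
move=> k; have [n Hn] := H k; exists n => i /Hn.
by rewrite /ahead /half /= !automorphism_dist.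
Qed.

Lemma end_orbitP (G : set (T -> T)) (omega eta : end_space T) :
  G `<=` @automorphism T ->
  end_orbit G omega eta <-> exists g r, [/\ G g, val omega r & val eta (g \o r)].
Proof.
move=> GA; split=> [[g Gg E]|[g [r [Gg xir etagr]]]].
  have [r xir] := end_inhabited omega.
  by exists g, r; split=> //; rewrite E; exists r.
have ag := GA g Gg; exists g => //; apply/seteqP; split=> [s etas|_ [s xis <-]].
  have [h [ah gh hg]] := automorphism_inv ag.
  have E (q : nat -> T) : g \o (h \o q) = q by apply/funext => i /=; rewrite hg.
  have E' (q : nat -> T) : h \o (g \o q) = q by apply/funext => i /=; rewrite gh.
  exists (h \o s) => //; apply: (end_mem xir).
    exact/automorphism_ray/(end_ray etas).
  rewrite -(E' r); apply: automorphism_end_equiv => //.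
  - exact: end_ray etagr.
  - exact: end_ray etas.
  - exact: end_rel etas.
apply: (end_mem etagr); first exact/automorphism_ray/(end_ray xis).
apply: automorphism_end_equiv => //; [exact: end_ray xir|exact: end_ray xis|exact: end_rel xis].
Qed.

End Trees.

(** * Sides of tree edges and convergence to ends of the tree *)

Section Sides.
Variables (X T : graph) (beta : T -> set X).
Hypothesis X_connected : graph_connected X.
Hypothesis T_dec : tree_decomposition beta.
Hypothesis T_adhesion : finite_adhesion beta.
Implicit Types (x y : X) (r : nat -> X) (s t u v : T) (tau : nat -> T).
Let T_tree : is_tree T. Proof. by case: T_dec. Qed.
Let T_connected : graph_connected T := T_tree.1.
Local Notation tri := (dist_triangle X_connected).

(* The set V_u^e of the paper, for e = uv. *)
Definition bags u v : set X := [set x | exists2 s, half u v s & beta s x].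

Lemma side_sub_bags u v : adj u v -> side beta u v `<=` bags u v.
Proof.
move=> uv x [s /= [n [p [pp <- _]]] sx]; exists (last u p) => //.
have H q w : half u v w -> path (edge_deleted_adj u v) w q -> half u v (last w q).
  elim: q w => //= z q IH w hw /andP[/andP[wz nd] pq].
  apply: IH pq; have [//|hz] := half_total T_tree z uv.
  have [E1 E2] := half_cross T_tree uv wz hw hz.
  by rewrite E1 E2 !eqxx in nd.
by apply: H pp; exact: (half_self T_tree).
Qed.

Lemma bags_total u v x : adj u v -> bags u v x \/ bags v u x.
Proof.
move=> uv; have [_ /(_ x) [s sx] _ _] := T_dec.
by have [h|h] := half_total T_tree s uv; [left|right]; exists s.
Qed.

(** The vertices whose bags contain [x] form a connected set meeting both halves, so a walk inside
    it traverses the edge [uv]. *)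
Lemma bags_both u v x : adj u v -> bags u v x -> bags v u x -> (beta u `&` beta v) x.
Proof.
move=> uv [s hs sx] [s' hs' s'x]; have [_ _ _ /(_ x) conn] := T_dec.
have xs : s \in [set t | beta t x] by rewrite inE.
have xs' : s' \in [set t | beta t x] by rewrite inE.
have [n [p [pp lp _]]] := conn (exist _ s xs) (exist _ s' xs').
have {lp} : half v u (val (last (exist _ s xs : induced _) p)) by rewrite lp.
have {hs} : half u v (val (exist _ s xs : induced [set t | beta t x])) by [].
move: (exist _ s xs) pp => a; elim: p a => [|b p IH] a /=; first by move=> _ /half_asym.
move=> /andP[ab pp] ha; have [hb|hb] := half_total T_tree (val b) uv; first exact: IH.
have [<- <-] := half_cross T_tree uv ab ha hb => _; split.
- exact: (set_mem (valP a)).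
- exact: (set_mem (valP b)).
Qed.

Lemma bags_self u v x : adj u v -> beta u x -> bags u v x.
Proof. by move=> uv ux; exists u => //; exact: (half_self T_tree). Qed.

Lemma bags_adj u v x y : adj u v -> adj x y -> bags u v x -> ~ (beta u `&` beta v) x ->
  bags u v y.
Proof.
move=> uv xy uvx nS; have [_ _ /(_ x y xy) [s [sx sy]] _] := T_dec.
have [h|h] := half_total T_tree s uv; first by exists s.
by case: nS; apply: bags_both => //; exists s.
Qed.

Lemma bags_crossing u v r m n : adj u v -> m <= n ->
  (forall i, m <= i -> i < n -> adj (r i) (r i.+1)) ->
  bags u v (r m) -> bags v u (r n) ->
  exists i, [/\ m <= i, i <= n & (beta u `&` beta v) (r i)].
Proof.
move=> uv /subnK; move: (n - m) => k; elim: k m => [|k IH] m E adjr uvm vun.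
  rewrite -E in vun *; by exists m; split=> //; exact: bags_both.
have [S|nS] := pselect ((beta u `&` beta v) (r m)).
  by exists m; split=> //; lia.
have [||||i [mi i_n Si]] := IH m.+1; first by lia.
- by move=> i mi i_n; apply: adjr; lia.
- by apply: bags_adj uvm nS => //; apply: adjr; lia.
- by [].
by exists i; split=> //; lia.
Qed.

Lemma adhesion_leave u v x0 : adj u v -> exists M, forall n r i,
  geodesic_upto n r -> r 0 = x0 -> i <= n -> M < i -> ~ (beta u `&` beta v) (r i).
Proof.
move=> uv; have [M HM] := finite_set_dist_bound x0 (T_adhesion uv).
exists M => n r i gr r0 i_n Mi /HM.
by rewrite -r0 gr // subn0; lia.
Qed.

(* Past time M a geodesic from x0 no longer meets the adhesion set, so its side is
   decided by its endpoint. *)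
Lemma bags_geodesic u v x0 : adj u v -> exists M, forall n r i,
  geodesic_upto n r -> r 0 = x0 -> bags u v (r n) -> i <= n -> M < i -> bags u v (r i).
Proof.
move=> uv; have [M HM] := adhesion_leave x0 uv; exists M => n r i gr r0 rn i_n Mi.
have [//|vui] := bags_total (r i) uv.
have vu : adj v u by rewrite adj_sym.
have [|j [ij jn [vj uj]]] := bags_crossing vu i_n _ vui rn.
  by move=> j _ jn; apply: geodesic_adj gr jn.
by case: (HM n r j gr r0 jn (leq_trans Mi ij)).
Qed.

Definition toward u v r := has_tail_in (bags u v) r.

Lemma toward_nested a b u v r : half a b `<=` half u v -> toward a b r -> toward u v r.
Proof. by move=> sub [n Hn]; exists n => i /Hn [s /sub hs sx]; exists s. Qed.

Lemma toward_total u v r : adj u v -> geodesic_ray r -> toward u v r \/ toward v u r.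
Proof.
move=> uv gr; have vu : adj v u by rewrite adj_sym.
have [M HM] := adhesion_leave (r 0) uv.
have stay a b : adj a b -> beta a `&` beta b `<=` beta u `&` beta v ->
    bags a b (r M.+1) -> toward a b r.
  move=> ab sub abM; exists M.+1 => i Mi; have [//|bai] := bags_total (r i) ab.
  have [|j [Mj ji /sub]] := bags_crossing ab Mi _ abM bai.
    by move=> j _ _; have [_] := geodesic_ray_ray X_connected gr; apply.
  by case/(HM j r j (geodesic_ray_upto gr)).
have [h|h] := bags_total (r M.+1) uv; [left|right]; apply: stay => //.
by move=> x [].
Qed.

Lemma toward_meet a b u v r : adj a b -> adj u v -> geodesic_ray r ->
  toward a b r -> toward u v r -> exists s, half a b s /\ half u v s.
Proof.
move=> ab uv gr [m Hm] [n Hn]; have [M HM] := adhesion_leave (r 0) uv.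
pose i := m + n + M.+1.
have [|s has sx] := Hm i; first by rewrite /i; lia.
exists s; split=> //; have [//|hvu] := half_total T_tree s uv.
case: (HM i r i (geodesic_ray_upto gr)); rewrite // /i; first by lia.
by apply: bags_both; [|apply: Hn; lia|exists s].
Qed.

Lemma toward_asym u v r : adj u v -> geodesic_ray r -> toward u v r -> ~ toward v u r.
Proof.
move=> uv gr uvr vur; have vu : adj v u by rewrite adj_sym.
by have [x [/half_asym]] := toward_meet uv vu gr uvr vur.
Qed.

(** A geodesic of length at most [C] from [r i] to the other side crosses the adhesion set, so [r i]
    would stay within [C] of a finite set for all late [i]. *)
Lemma toward_near u v r C N : adj u v -> geodesic_ray r -> toward u v r ->
  ~ (forall i, N <= i -> exists2 y, bags v u y & dist (r i) y <= C).
Proof.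
move=> uv gr [n Hn] near; have [M HM] := finite_set_dist_bound (r 0) (T_adhesion uv).
pose i := n + N + M + C.+1; have [|y vuy ry] := near i; first by rewrite /i; lia.
have [q [q0 qn gq]] := geodesic_segment X_connected (r i) y.
have [|||j [_ jl Sj]] := bags_crossing uv (leq0n (dist (r i) y)) (r := q).
- by move=> j _ jl; exact: geodesic_adj gq jl.
- by rewrite q0; apply: Hn; rewrite /i; lia.
- by rewrite qn.
have := HM _ Sj; have := gq 0 j (leq0n _) jl; have := gr 0 i (leq0n _).
by have := tri (q j) (r 0) (r i); rewrite q0 (dist_sym X_connected (q j)) /i; lia.
Qed.

Lemma toward_fhd u v r r' : adj u v -> geodesic_ray r -> geodesic_ray r' ->
  finite_hausdorff_distance r r' -> toward u v r -> toward u v r'.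
Proof.
move=> uv gr gr' rr' uvr; have [//|[n Hn]] := toward_total uv gr'.
have [C HC] := fhd_near_pointwise X_connected gr gr' rr'.
by case: (@toward_near u v r C n uv gr uvr) => i ni; exists (r' i) => //; exact: Hn.
Qed.

Lemma toward_crossing u v r N : adj u v -> geodesic_ray r -> toward u v r ->
  bags v u (r N) -> exists2 i, N <= i & (beta u `&` beta v) (r i).
Proof.
move=> uv gr [n Hn] vuN; have vu : adj v u by rewrite adj_sym.
have Nn : N <= N + n by lia.
have [||i [Ni _ [vi ui]]] := bags_crossing vu Nn _ vuN.
- by move=> i _ _; have [_] := geodesic_ray_ray X_connected gr; apply.
- by apply: Hn; lia.
by exists i.
Qed.

Definition toward_set u v : set (gromov_boundary X) :=
  [set xi | exists2 r, val xi r & toward u v r].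

Lemma toward_setP u v xi r : adj u v -> val xi r -> toward_set u v xi <-> toward u v r.
Proof.
move=> uv xir; split=> [[r' xir' uvr']|]; last by exists r.
apply: toward_fhd uvr' => //.
- exact: boundary_geodesic xir'.
- exact: boundary_geodesic xir.
- exact: boundary_fhd xir' xir.
Qed.

Lemma toward_set_open u v : adj u v -> open (toward_set u v).
Proof.
move=> uv; apply: boundary_open_seq => xi r eta s uvxi xir etas sr.
have [n Hn] := (toward_setP uv xir).1 uvxi.
have [M HM] := adhesion_leave (r 0) uv.
pose N := n + M.+1; exists N; apply/(toward_setP uv (etas N)).
have gs := boundary_geodesic (etas N).
exists N => i Ni; have [//|vui] := bags_total (s N i) uv.
have [||j [Nj ji]] := bags_crossing uv Ni _ _ vui.
- by move=> j _ _; have [_] := geodesic_ray_ray X_connected gs; apply.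
- by rewrite sr //; apply: Hn; rewrite /N; lia.
by case/(HM j _ j (geodesic_ray_upto gs)); rewrite ?sr //; move: Nj; rewrite /N; lia.
Qed.

Definition tends r tau := forall k, toward (tau k.+1) (tau k) r.

Lemma ahead_eventually tau tau' k : ray tau -> ray tau' ->
  (forall m, exists s, ahead tau' m s /\ ahead tau k s) ->
  exists m, ahead tau' m `<=` ahead tau k.
Proof.
(* For this [m], [ahead_bound] shows that [ahead tau' m] misses [tau k], as [half_nested]
   requires. *)
move=> rt rt' meet; pose m := dist (tau k) (tau' 0); exists m.
have [x [mx kx]] := meet m.
apply: (half_nested T_tree) mx kx _; [exact: ray_adj|exact: ray_adj|].
by move=> /(ahead_bound T_tree rt'); rewrite ltnn.
Qed.

Lemma tends_toward r tau tau' k : ray tau -> ray tau' -> tends r tau' ->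
  has_tail_in (ahead tau k) tau' -> toward (tau k.+1) (tau k) r.
Proof.
move=> rt rt' rtau' [n Hn].
have [|m mk] := ahead_eventually (k := k) rt rt'.
  move=> m; exists (tau' (n + m).+1); split; last by apply: Hn; lia.
  by apply: (ahead_tail T_tree) => //; lia.
exact: toward_nested mk (rtau' m).
Qed.

Lemma tends_tail r tau tau' k : ray tau -> ray tau' -> geodesic_ray r -> tends r tau' ->
  toward (tau k.+1) (tau k) r -> has_tail_in (ahead tau k) tau'.
Proof.
move=> rt rt' gr rtau' rk; have [|m mk] := ahead_eventually (k := k) rt rt'.
  by move=> m; apply: toward_meet gr (rtau' m) rk; exact: ray_adj.
by exists m.+1 => i mi; apply: mk; exact: (ahead_tail T_tree).
Qed.

Definition limit_end (xi : gromov_boundary X) (omega : end_space T) : Prop :=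
  exists r tau, [/\ val xi r, val omega tau & tends r tau].

Lemma limit_end_tends xi omega r tau : limit_end xi omega -> val xi r -> val omega tau ->
  tends r tau.
Proof.
move=> [r' [tau' [xir' ot' rt']]] xir ot k.
have rayt := end_ray ot; have rayt' := end_ray ot'; have adjk := ray_adj k rayt.
apply: (@toward_fhd _ _ r') => //; [exact: boundary_geodesic xir'|exact: boundary_geodesic xir| |].
  exact: boundary_fhd xir' xir.
apply: tends_toward rt' _ => //.
by apply: end_equiv_ahead => //; exact: end_rel ot ot'.
Qed.

Lemma limit_end_fun xi omega omega' :
  limit_end xi omega -> limit_end xi omega' -> omega = omega'.
Proof.
move=> R R'; have [r xir] := boundary_inhabited xi.
have [tau ot] := end_inhabited omega; have [tau' ot'] := end_inhabited omega'.
have rt := limit_end_tends R xir ot; have rt' := limit_end_tends R' xir ot'.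
apply: (end_eq (r := tau')) => //; apply: (end_mem ot (end_ray ot')).
apply/(end_equivP T_tree (end_ray ot) (end_ray ot')) => k.
exact: (tends_tail (end_ray ot) (end_ray ot') (boundary_geodesic xir) rt' (rt k)).
Qed.

(** Inside a basic neighbourhood of an end lies some [ahead tau k]; the boundary points directed
    across that edge form an open set whose limit ends all belong to [U]. *)
Lemma limit_end_continuous : rel_continuous limit_end.
Proof.
move=> U oU.
pose good (uv : T * T) := adj uv.1 uv.2 /\
  forall xi omega, limit_end xi omega -> toward_set uv.1 uv.2 xi -> U omega.
exists (\bigcup_(uv in good) toward_set uv.1 uv.2).
  by apply: bigcup_open => -[u v] [uv _]; exact: toward_set_open.
move=> xi omega R; split=> [[[u v] [_ H] uvxi]|Uo]; first exact: H R uvxi.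
have [_ [[S [C [fS cC ->]]] oC CU]] := oU _ Uo.
have [tau ot] := end_inhabited omega; have rt := end_ray ot.
have [k kS] := ahead_avoid T_tree rt fS; have adjk := ray_adj k rt.
have [r xir] := boundary_inhabited xi.
exists (tau k.+1, tau k) => /=; last first.
  by apply/(toward_setP adjk xir); exact: (limit_end_tends R xir ot).
split=> // xi' omega' R' xi'k; apply: CU => tau' ot' /=.
have [r' xir'] := boundary_inhabited xi'.
have [n Hn] := tends_tail rt (end_ray ot') (boundary_geodesic xir')
  (limit_end_tends R' xir' ot') ((toward_setP adjk xir').1 xi'k).
have [m Hm] := oC _ ot; pose i := m + k.+1.
exists n => j /Hn; apply: (half_sub_component T_tree cC adjk kS (x := tau i)).
- by apply: Hm; rewrite /i; lia.
- by apply: (ahead_tail T_tree) => //; rewrite /i; lia.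
Qed.

Definition stays t r := forall u, adj t u -> toward t u r.

(** On the path between two such vertices the first edge would point back to [t] and the last one to
    [t'], but the corresponding halves are disjoint. *)
Lemma stays_unique t t' r : geodesic_ray r -> stays t r -> stays t' r -> t = t'.
Proof.
move=> gr st st'; apply/eqP; apply/negPn/negP => tt'.
have t't : t' != t by rewrite eq_sym.
have [u tu lt] := tree_parent T_tree tt'; have [u' t'u' lt'] := tree_parent T_tree t't.
have u't' : adj u' t' by rewrite adj_sym.
apply: (toward_asym u't' gr) (st' u' t'u'); apply: toward_nested (st u tu).
apply: (half_nested T_tree tu u't' (x := t)); first exact: (half_self T_tree).
- by rewrite /half /= !(dist_sym T_connected t).
- by rewrite /half /= !(dist_sym T_connected t'); lia.
Qed.

Lemma stays_tends t r tau : geodesic_ray r -> ray tau -> stays t r -> ~ tends r tau.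
Proof.
move=> gr rt st rtau; pose k := dist t (tau 0).
have tk : ~ ahead tau k t by move=> /(ahead_bound T_tree rt); rewrite ltnn.
have kk : ahead tau k (tau k.+1) by exact: (ahead_tail T_tree).
have ntk : t != tau k.+1 by apply/eqP => E; apply: tk; rewrite E.
have [u tu lt] := tree_parent T_tree ntk.
have ut : adj u t by rewrite adj_sym.
apply: (toward_asym ut gr) (st u tu); apply: toward_nested (rtau k).
apply: (half_nested T_tree (ray_adj k rt) ut kk _ tk).
by rewrite /half /= !(dist_sym T_connected (tau k.+1)).
Qed.

Lemma stays_or_tends r : geodesic_ray r ->
  (exists t, stays t r) \/ exists2 tau, ray tau & tends r tau.
Proof.
move=> gr; have [|none] := pselect (exists t, stays t r); [by left|right].
have next t : exists u, adj t u /\ toward u t r.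
  have /existsNP[u /not_implyP[tu ntu]] : ~ stays t r by move=> st; apply: none; exists t.
  by exists u; split=> //; have [] := toward_total tu gr.
(* Iterated outgoing edges never backtrack, since no edge is oriented both ways; in a tree such a
   walk is a ray. *)
have [f Hf] := choice next; have [_ /(_ (r 0)) [t0 _] _ _] := T_dec.
pose tau k := iter k f t0.
have adjt k : adj (tau k) (tau k.+1) by exact: (Hf (tau k)).1.
have tow k : toward (tau k.+1) (tau k) r by exact: (Hf (tau k)).2.
exists tau => //; apply: geodesic_ray_ray => //.
apply: nonbacktracking_geodesic => // k E.
by apply: (toward_asym (adjt k) gr) (tow k); rewrite -E; exact: tow.
Qed.

(** A bag containing [r N], if not at [t], lies beyond an edge at [t] that points to [t]; crossing
    back, [r] meets the adhesion set of that edge. *)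
Lemma stays_return t r N : geodesic_ray r -> stays t r -> exists2 i, N <= i & beta t (r i).
Proof.
move=> gr st; have [_ /(_ (r N)) [s sN] _ _] := T_dec.
have [<-|ts] := eqVneq s t; first by exists N.
have [|u tu lt] := tree_parent T_tree (s := s) (x := t); first by rewrite eq_sym.
have [|i Ni [ti _]] := toward_crossing (N := N) tu gr (st u tu); last by exists i.
by exists s => //; rewrite /half /= !(dist_sym T_connected s).
Qed.

Lemma near_bag_stays t r q : geodesic_ray r -> (forall j, beta t (q j)) ->
  finite_hausdorff_distance r q -> stays t r.
Proof.
move=> gr tq [C [rq _]] u tu; have [//|utr] := toward_total tu gr.
have ut : adj u t by rewrite adj_sym.
case: (@toward_near u t r C 0 ut gr utr) => i _; have [j ij] := rq i.
by exists (q j) => //; exact: bags_self.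
Qed.

Section HyperbolicSides.
Hypothesis X_locally_finite : locally_finite X.
Hypothesis X_hyperbolic : hyperbolic X.
Hypothesis bounded_adhesion : exists D, forall u v, adj u v ->
  forall a b, (beta u `&` beta v) a -> (beta u `&` beta v) b -> dist a b <= D.

Lemma limit_end_inj xi xi' omega :
  limit_end xi omega -> limit_end xi' omega -> xi = xi'.
Proof.
have [D X4] := hyperbolic_four_point X_hyperbolic; have [E HE] := bounded_adhesion.
move=> R R'; have [tau ot] := end_inhabited omega; have rt := end_ray ot.
have [r xir] := boundary_inhabited xi; have [r' xir'] := boundary_inhabited xi'.
have gr := boundary_geodesic xir; have gr' := boundary_geodesic xir'.
have tr := limit_end_tends R xir ot; have tr' := limit_end_tends R' xir' ot.
have [_ bag _ _] := T_dec.
(* With [r N] and [r' 0] behind the [k]-th edge, [r] crosses its adhesion set after time [N] and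
   [r'] crosses it too: the recurrent closeness asked for by [ray_fellow_travel]. *)
have behind x : exists m, forall k, m <= k -> bags (tau k) (tau k.+1) x.
  have [s sx] := bag x; exists (dist s (tau 0)) => k mk; exists s => //.
  have [//|/(ahead_bound T_tree rt)] := half_total T_tree s (rt.2 k).
  by lia.
apply: (boundary_eq X_connected (r := r')) => //.
apply: (boundary_mem X_connected xir gr'); apply: fhd_pointwise.
apply: (ray_fellow_travel X_connected X4 (E := E)) => // N.
have [m Hm] := behind (r N); have [m' Hm'] := behind (r' 0).
pose k := m + m'; have adjk := ray_adj k rt.
have [|i Ni Si] := toward_crossing (N := N) adjk gr (tr k); first by apply: Hm; rewrite /k; lia.
have [|j _ Sj] := toward_crossing (N := 0) adjk gr' (tr' k); first by apply: Hm'; rewrite /k; lia.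
by exists i, j; split=> //; exact: HE adjk _ _ Si Sj.
Qed.

Section EndEssential.
Hypothesis T_essential : end_essential beta.

Lemma limit_end_surj omega : exists xi, limit_end xi omega.
Proof.
have [tau ot] := end_inhabited omega; have rt := end_ray ot.
(* End-essentiality puts the tail of a ray of [X] beyond the [k]-th edge, and a ray leaves every
   finite ball. *)
have far x0 k : exists y, bags (tau k.+1) (tau k) y /\ k <= dist x0 y.
  have adjk := ray_adj k rt; have [eps [r rr epsE] epsS] := T_essential adjk.
  have [n Hn] : has_tail_in (side beta (tau k.+1) (tau k)) r.
    by apply: epsS; rewrite -epsE; split=> //; exact: ray_end_equiv.
  have [C [cC [m Hm] _]] := ray_end_equiv rr (finite_ball X_connected x0 k X_locally_finite).
  exists (r (n + m)); split; first by apply: side_sub_bags => //; apply: Hn; lia.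
  have := component_subC cC (Hm (n + m) (leq_addl _ _)).
  by rewrite /=; lia.
have [x0 _] : exists x0 : X, True.
  have [eps [r _ _] _] := T_essential (ray_adj 0 rt); by exists (r 0).
have [y Hy] := choice (far x0).
have seg k : exists q, [/\ q 0 = x0, geodesic_upto k q
    & exists2 n, k <= n & geodesic_upto n q /\ q n = y k].
  have [q [q0 qn gq]] := geodesic_segment X_connected x0 (y k).
  have ky := (Hy k).2; exists q; split=> //; first exact: geodesic_upto_le gq.
  by exists (dist x0 (y k)).
have [F HF] := choice seg.
have [|n|r [r0 gr rF]] := @geodesic_limit X x0 F X_connected X_locally_finite.
- by move=> n; have [] := HF n.
- by have [] := HF n.
have [xi xir] := boundary_class gr; exists xi, r, tau; split=> // j.
(* [M] depends only on [x0] and the edge, so it applies to all segments ending beyond the [j]-th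
   edge and passes to their limit. *)
have adjj := ray_adj j rt; have [M HM] := bags_geodesic x0 adjj.
exists M.+1 => i Mi; have [k [ijk kF]] := rF (i + j).
have [F0 _ [n kn [gF Fn]]] := HF k.
rewrite -kF; last by lia.
apply: (HM n) => //; last by lia.
rewrite Fn; have [[s ks sy] _] := Hy k; exists s => //.
by apply: (ahead_mono T_tree rt (m := k)) ks; lia.
Qed.

(** Otherwise there are points outside [U] directed across later and later edges of [tau].
    Representatives from one vertex have a limit that tends to [tau], hence represents [xi] by
    injectivity, against openness of [U]. *)
Lemma limit_end_inv_continuous : rel_continuous (fun omega xi => limit_end xi omega).
Proof.
move=> U oU; exists [set omega | exists2 xi, limit_end xi omega & U xi]; last first.
  move=> omega xi R; split=> [[xi' R' Uxi']|Uxi]; last by exists xi.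
  by rewrite (limit_end_inj R R').
move=> omega [xi R Uxi].
have [tau ot] := end_inhabited omega; have rt := end_ray ot.
(* The component of [T] minus [tau k] containing [tau k.+1] is exactly [ahead tau k]. *)
have nbhd k : exists2 V, end_basic V & V omega /\ forall eta sigma, V eta ->
    val eta sigma -> has_tail_in (ahead tau k) sigma.
  have adjk := ray_adj k rt.
  have avoid v : ahead tau k v -> ~ [set tau k] v.
    move=> ky /= E; move: ky; rewrite E => /half_asym; apply.
    by apply: (half_self T_tree); rewrite adj_sym.
  have kk : ahead tau k (tau k.+1) by exact: (ahead_tail T_tree).
  have [C cC Ck] := component_at (avoid _ kk).
  have aC := half_sub_component T_tree cC adjk avoid Ck kk.
  have Ca : C `<=` ahead tau k := component_sub_half T_tree cC adjk (erefl _) Ck kk.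
  exists [set eps : end_space T | forall sigma, val eps sigma -> has_tail_in C sigma].
    by exists [set tau k], C; split=> //; exact: finite_set1.
  split=> [sigma os|eta sigma Veta etas].
    have [n Hn] := end_equiv_ahead T_tree k rt (end_rel ot os).
    by exists n => i /Hn /aC.
  by have [n Hn] := Veta _ etas; exists n => i /Hn /Ca.
apply: contrapT => nV; have [r xir] := boundary_inhabited xi.
have {}nV k : exists eta_s : gromov_boundary X * (nat -> X), [/\ ~ U eta_s.1,
    val eta_s.1 eta_s.2, eta_s.2 0 = r 0 & toward (tau k.+1) (tau k) eta_s.2].
  have [V bV [Vo Vtail]] := nbhd k.
  have /existsNP[omega' /not_implyP[Vo' nWo']] : ~ (V `<=`
      [set omega | exists2 xi, limit_end xi omega & U xi]).
    by move=> VW; apply: nV; exists V.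
  have [xi' R'] := limit_end_surj omega'.
  have [s xis s0] := ray_from X_connected X_locally_finite X_hyperbolic xi' (r 0).
  exists (xi', s); split=> //=; first by move=> Uxi'; apply: nWo'; exists xi'.
  have [tau' ot'] := end_inhabited omega'.
  apply: (tends_toward rt (end_ray ot')); first exact: limit_end_tends R' xis ot'.
  exact: Vtail ot'.
have [F HF] := choice nV.
have gF k : geodesic_ray (F k).2 by have [_ /boundary_geodesic] := HF k.
have [|n|r' [r'0 gr' rF]] := @geodesic_limit X (r 0) (fun k => (F k).2)
  X_connected X_locally_finite.
- by move=> n; have [] := HF n.
- exact: geodesic_ray_upto.
have [xi' xi'r'] := boundary_class gr'.
have R' : limit_end xi' omega.
  exists r', tau; split=> // j; have adjj := ray_adj j rt.
  have [M HM] := bags_geodesic (r 0) adjj.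
  exists M.+1 => i Mi; have [k [ijk kF]] := rF (i + j).
  rewrite -kF; last by lia.
  have [_ _ F0 tk] := HF k.
  have jk : j <= k by lia.
  have [n Hn] := toward_nested (ahead_mono T_tree rt jk) tk.
  apply: (HM (n + i)) => //; first exact: geodesic_ray_upto.
  - by apply: Hn; lia.
  - by lia.
rewrite (limit_end_inj R R') in Uxi.
have [N HN] := oU xi' r' Uxi xi'r'; have [k [Nk kF]] := rF N.
by have [nU Fk _ _] := HF k; apply: nU; exact: HN Fk kF.
Qed.

End EndEssential.
End HyperbolicSides.
End Sides.

(** * Bags and the group action *)

Section Induced.
Variables (X : graph) (A : set X).
Implicit Types a b : induced A.

Lemma incl_in a : A (incl a).
Proof. exact: (set_mem (valP (a : set_type A))). Qed.

Lemma incl_inj : injective (@incl X A).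
Proof. by move=> a b /val_inj. Qed.

Lemma incl_surj x : A x -> exists a : induced A, incl a = x.
Proof. by move=> Ax; have xA : x \in A by [rewrite inE]; exists (exist _ x xA). Qed.

Lemma induced_locally_finite : locally_finite X -> locally_finite (induced A).
Proof.
move=> lf a; apply: (finite_preimage (f := @incl X A) (B := [set y | adj (incl a) y])).
  by move=> b c _ _; exact: incl_inj.
exact: lf.
Qed.

End Induced.

Lemma hom_dist (Z W : graph) (h : Z -> W) (a b : Z) : graph_connected Z ->
  (forall c d, adj c d -> adj (h c) (h d)) -> dist (h a) (h b) <= dist a b.
Proof.
move=> Z_conn hadj; apply: dist_le; have [p [pp <- sp]] := dist_walk (Z_conn a b).
exists (map h p); rewrite last_map size_map sp; split=> //.
by rewrite path_map; apply: sub_path pp => c d; exact: hadj.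
Qed.

Section Distortion.
Variables (X T : graph) (beta : T -> set X).
Hypothesis X_connected : graph_connected X.
Hypothesis T_dec : tree_decomposition beta.
Hypothesis bags_connected : forall t : T, graph_connected (induced (beta t)).

(** Distances are those of the induced graph on the bag, where the replacement of a detour has to
    run. *)
Definition adhesion_bound (t u : T) (K : nat) : Prop :=
  forall a b : induced (beta t), beta u (incl a) -> beta u (incl b) -> dist a b <= K.

Lemma adhesion_bound_exists t u : finite_set (beta t `&` beta u) ->
  exists K, adhesion_bound t u K.
Proof.
move=> fS; have fS' : finite_set [set a : induced (beta t) | beta u (incl a)].
  apply: (@sub_finite_set _ _ (@incl X (beta t) @^-1` (beta t `&` beta u))).
    by move=> a ua; split=> //; exact: incl_in.
  by apply: finite_preimage fS => a b _ _; exact: incl_inj.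
have [[a0 ua0]|none] := pselect (exists a : induced (beta t), beta u (incl a)); last first.
  by exists 0 => a b ua; case: none; exists a.
have [M HM] := finite_set_dist_bound a0 fS'; exists (2 * M) => a b ua ub.
have := dist_triangle (@bags_connected t) a0 a b.
have := HM a ua; have := HM b ub.
by rewrite (dist_sym (@bags_connected t) a a0); lia.
Qed.

(* An excursion of a path of X out of a bag leaves and re-enters through the same
   adhesion set, so it can be replaced by a path of length at most K in the bag. *)
Lemma bag_qi_embedding t K : 0 < K -> (forall u, adj t u -> adhesion_bound t u K) ->
  qi_embedding K (@incl X (beta t)).
Proof.
move=> K0 HK a b; split; first by apply: hom_dist.
have T_tree : is_tree T by case: T_dec.
have T_connected := T_tree.1.
(* Outside the bag, in direction [u], distances are measured from an arbitrary [c] in the adhesion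
   set, standing for the point of exit. Leaving is then free, and the step that re-enters pays
   [K]. *)
have H n x (y : induced (beta t)) : has_walk x (incl y) n ->
   (forall c : induced (beta t), incl c = x -> dist c y <= K * n) /\
   (forall u, adj t u -> bags beta u t x -> ~ beta t x ->
     forall c : induced (beta t), beta u (incl c) -> dist c y <= K * n).
  elim: n x => [|n IH] x [p [pp py pn]].
    case: p pn pp py => //= _ _ xy; split=> [c cx|u _ _ ntx].
      by rewrite (_ : c = y) ?distxx //; apply: incl_inj; rewrite cx.
    by case: ntx; rewrite xy; exact: incl_in.
  case: p pn pp py => //= x' p [pn] /andP[xx' pp] py.
  have [IH1 IH2] : _ /\ _ := IH x' (ex_intro _ p (And3 pp py pn)).
  have tri := dist_triangle (@bags_connected t).
  have [tx'|ntx'] := pselect (beta t x').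
    have [a' a'x'] := incl_surj tx'; have := IH1 a' a'x' => da'.
    split=> [c cx|u tu ux ntx c uc].
      have ca' : adj (incl c) (incl a') by rewrite cx a'x'.
      have : dist (c : induced (beta t)) a' <= 1 by exact: dist_adj_le.
      by have := tri a' c y; rewrite mulnS; lia.
    have ut : adj u t by rewrite adj_sym.
    have ux' : bags beta u t x' by apply: (bags_adj T_dec ut xx' ux) => -[].
    have tux' : bags beta t u x' by exact: bags_self.
    have [ux'' _] := bags_both T_dec ut ux' tux'.
    have : dist (c : induced (beta t)) a' <= K by apply: (HK u tu) => //; rewrite a'x'.
    by have := tri a' c y; rewrite mulnS; lia.
  split=> [c cx|u tu ux ntx c uc].
    have [_ _ /(_ x x' xx') [s [sx sx']] _] := T_dec.
    have st : t != s by apply/eqP => E; apply: ntx'; rewrite E.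
    have [u tu lt] := tree_parent T_tree st.
    have ut : adj u t by rewrite adj_sym.
    have us : half u t s by rewrite /half /= !(dist_sym T_connected s).
    have tx : beta t x by rewrite -cx; exact: incl_in.
    have [ux _] : (beta u `&` beta t) x.
      by apply: (bags_both T_dec ut); [exists s|exact: bags_self].
    have := IH2 u tu _ ntx' c; rewrite cx mulnS => /(_ _ ux).
    by move=> le; apply: leq_trans (le _) _; [exists s|lia].
  have ut : adj u t by rewrite adj_sym.
  have ux' : bags beta u t x' by apply: (bags_adj T_dec ut xx' ux) => -[].
  by have := IH2 u tu ux' ntx' c uc; rewrite mulnS; lia.
by have [H1 _] := H _ _ _ (dist_walk (X_connected (incl a) (incl b))); exact: H1.
Qed.

End Distortion.

(** * Uniform constants and equivariance *)

Section GroupAction.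
Variables (X T : graph) (G : set (X -> X)) (act : (X -> X) -> T -> T) (beta : T -> set X).
Hypothesis X_connected : graph_connected X.
Hypothesis X_locally_finite : locally_finite X.
Hypothesis X_hyperbolic : hyperbolic X.
Hypothesis G_subgroup : aut_subgroup G.
Hypothesis T_dec : tree_decomposition beta.
Hypothesis T_invariant : invariant_decomposition beta G act.
Hypothesis bags_connected : forall t : T, graph_connected (induced (beta t)).
Hypothesis T_adhesion : finite_adhesion beta.
Hypothesis finite_edge_quotient : finite_set (edge_orbits (act @` G)).
Implicit Types (g h : X -> X) (s t u v : T) (r : nat -> X) (tau : nat -> T).
Let T_tree : is_tree T. Proof. by case: T_dec. Qed.
Let T_connected : graph_connected T := T_tree.1.

Lemma group_automorphism g : G g -> automorphism g.
Proof. by have [GA _ _ _] := G_subgroup; exact: GA. Qed.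

Lemma act_automorphism g : G g -> automorphism (act g).
Proof. by have [[aA _ _] _] := T_invariant; exact: aA. Qed.

Lemma act_image_automorphism : act @` G `<=` @automorphism T.
Proof. by move=> _ [g Gg <-]; exact: act_automorphism. Qed.

Lemma act_comp g h t : G g -> G h -> act (g \o h) t = act g (act h t).
Proof. by have [[_ _ ac] _] := T_invariant => Gg Gh; rewrite ac. Qed.

Lemma act_id t : act id t = t.
Proof. by have [[_ -> _] _] := T_invariant. Qed.

Lemma group_id : G id. Proof. by have [] := G_subgroup. Qed.

Lemma group_comp g h : G g -> G h -> G (g \o h).
Proof. by have [_ _ Gc _] := G_subgroup; exact: Gc. Qed.

Lemma group_inv g : G g -> exists h, [/\ G h, cancel g h, cancel h g,
  cancel (act g) (act h) & cancel (act h) (act g)].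
Proof.
move=> Gg; have [_ _ _ /(_ g Gg) [h [Gh gh hg]]] := G_subgroup.
have E1 : h \o g = id by apply/funext => x /=; rewrite gh.
have E2 : g \o h = id by apply/funext => x /=; rewrite hg.
by exists h; split=> // t; rewrite -act_comp // ?E1 ?E2 act_id.
Qed.

Lemma beta_act g t x : G g -> beta t x -> beta (act g t) (g x).
Proof. by move=> Gg tx; have [_ ->] := T_invariant; last by []; exists x. Qed.

Lemma beta_act_inv g t x : G g -> beta (act g t) x -> exists2 y, beta t y & x = g y.
Proof. by move=> Gg; have [_ ->] := T_invariant; last by []; move=> [y ty <-]; exists y. Qed.

Lemma bags_act g u v x : G g -> bags beta u v x -> bags beta (act g u) (act g v) (g x).
Proof.
move=> Gg [s us sx]; exists (act g s); last exact: beta_act.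
by rewrite /half /= !automorphism_dist //; exact: act_automorphism.
Qed.

Lemma toward_act g u v r : G g -> toward beta u v r ->
  toward beta (act g u) (act g v) (g \o r).
Proof. by move=> Gg [n Hn]; exists n => i /Hn; exact: bags_act. Qed.

Lemma stays_act g t r : G g -> stays beta t r -> stays beta (act g t) (g \o r).
Proof.
move=> Gg st u tu; have [h [Gh gh hg agh ahg]] := group_inv Gg.
rewrite -(ahg u); apply: toward_act => //; apply: st.
by have [_ <-] := act_automorphism Gg; rewrite ahg.
Qed.

Lemma tends_act g r tau : G g -> tends beta r tau -> tends beta (g \o r) (act g \o tau).
Proof. by move=> Gg rt k; exact: toward_act. Qed.

(** Vertices other than a fixed [t0] lie on edges, and the edges form finitely many orbits of a
    countable group. *)
Lemma countable_tree : countable G -> countable [set: T].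
Proof.
move=> G_countable.
have [[t0]|nT] := pselect (inhabited T); last first.
  by rewrite (_ : [set: T] = set0) //; apply/seteqP; split=> // t _; case: nT.
have edge_countable : countable (@edges T).
  apply: (sub_countable (A := @edges T) (B := \bigcup_(O in edge_orbits (act @` G)) O)).
    apply: subset_card_le => e Ee; exists [set f @` e | f in act @` G]; first by exists e.
    exists id; last by rewrite image_id.
    by exists id; [exact: group_id|apply/funext => t; rewrite act_id].
  apply: bigcup_countable; first exact: finite_set_countable.
  move=> _ [e _ <-]; apply: sub_countable (card_image_le _ _) _.
  exact: sub_countable (card_image_le _ _) G_countable.
apply: (sub_countable (B := \bigcup_(e in [set [set t0]] `|` @edges T) e)).
  apply: subset_card_le => t _; have [->|tt0] := eqVneq t t0.
    by exists [set t0] => //; left.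
  have [u tu _] := tree_parent T_tree tt0.
  by exists [set t; u]; [right; exists t, u|left].
apply: bigcup_countable; last first.
  move=> _ [->|[u [v [_ ->]]]]; first exact: countable1.
  by apply: finite_set_countable; rewrite finite_setU; split; exact: finite_set1.
by rewrite -bigcup2E; apply: bigcup_countable => // -[|[|n]] _;
  [exact: countable1| |exact: countable0].
Qed.

Lemma adhesion_bound_act g t u K : G g -> adhesion_bound beta t u K ->
  adhesion_bound beta (act g t) (act g u) K.
Proof.
move=> Gg HK a b ua ub.
have lift (c : induced (beta (act g t))) : exists c' : induced (beta t), incl c = g (incl c').
  have [y ty cy] := beta_act_inv Gg (incl_in c); have [c' c'y] := incl_surj ty.
  by exists c'; rewrite c'y.
have /choice [h Hh] : forall c : induced (beta t), exists d : induced (beta (act g t)),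
    incl d = g (incl c).
  by move=> c; apply: incl_surj; apply: beta_act => //; exact: incl_in.
have [a' aa'] := lift a; have [b' bb'] := lift b.
have ha : a = h a' by apply: incl_inj; rewrite aa' Hh.
have hb : b = h b' by apply: incl_inj; rewrite bb' Hh.
have inj := bij_inj (group_automorphism Gg).1.
have drop c c' : beta (act g u) (incl c) -> incl c = g (incl c') -> beta u (incl c').
  by move=> + E; rewrite E => /(beta_act_inv Gg) [y uy /inj ->].
apply: leq_trans (HK a' b' (drop _ _ _ _ ua aa') (drop _ _ _ _ ub bb')).
rewrite ha hb; apply: hom_dist => // c d cd.
suff : adj (incl (h c)) (incl (h d)) by [].
by rewrite !Hh (group_automorphism Gg).2.
Qed.

Lemma adhesion_bound_uniform : exists K, 0 < K /\
  forall t u, adj t u -> adhesion_bound beta t u K.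
Proof.
pose P O K := forall t u, adj t u -> O [set t; u] -> adhesion_bound beta t u K.
have /choice [K HK] : forall O, exists K, edge_orbits (act @` G) O -> P O K.
  move=> O; have [|nO] := pselect (edge_orbits (act @` G) O); last by exists 0.
  move=> [_ [u0 [v0 [uv0 ->]]] <-].
  have vu0 : adj v0 u0 by rewrite adj_sym.
  have [K1 HK1] := adhesion_bound_exists bags_connected (T_adhesion uv0).
  have [K2 HK2] := adhesion_bound_exists bags_connected (T_adhesion vu0).
  (* Orbits are of unordered edges, so [g] may carry [u0] to [t] or to [u]; the sum covers both
     directions. *)
  exists (K1 + K2) => _ t u tu [_ [g Gg <-] E].
  have tneu : t <> u by move=> E'; rewrite E' adj_irrefl in tu.
  have : [set act g w | w in [set u0; v0]] t by rewrite E; left.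
  have : [set act g w | w in [set u0; v0]] u by rewrite E; right.
  move=> [w [->|->] gw] [w' [->|->] gw']; rewrite -gw -gw' // in tneu *.
  - by move=> a b ua ub; have := adhesion_bound_act Gg HK2 ua ub; lia.
  - by move=> a b ua ub; have := adhesion_bound_act Gg HK1 ua ub; lia.
have [M HM] : exists M, forall O, edge_orbits (act @` G) O -> K O <= M.
  have /(finite_image K) /finite_seqP [q Eq] := finite_edge_quotient.
  exists (\max_(a <- q) a) => O HO; have : [set` q] (K O) by rewrite -Eq; exists O.
  by move=> /= ?; exact: leq_bigmax_seq.
exists M.+1; split=> // t u tu a b ua ub.
pose O := [set f @` [set t; u] | f in act @` G].
have HO : edge_orbits (act @` G) O by exists [set t; u] => //; exists t, u.
have Otu : O [set t; u].
  by exists id; [exists id; [exact: group_id|apply/funext => w; rewrite act_id]|rewrite image_id].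
by have := HK O HO t u tu Otu a b ua ub; have := HM O HO; lia.
Qed.

Lemma bag_translate_qi : exists K, forall g t, G g ->
  qi_embedding K (g \o @incl X (beta t)).
Proof.
have [K [K0 HK]] := adhesion_bound_uniform; exists K => g t Gg a b.
rewrite /= automorphism_dist //; last exact: group_automorphism.
exact: (bag_qi_embedding X_connected T_dec bags_connected K0 (HK t)).
Qed.

Lemma bounded_adhesion : exists D, forall u v, adj u v ->
  forall a b, (beta u `&` beta v) a -> (beta u `&` beta v) b -> dist a b <= D.
Proof.
have [K [K0 HK]] := adhesion_bound_uniform; exists K => u v uv a b [ua va] [ub vb].
have [a' a'a] := incl_surj ua; have [b' b'b] := incl_surj ub.
rewrite -a'a -b'b; apply: leq_trans (hom_dist _ _ (@bags_connected u) _) _ => //.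
by apply: (HK u v uv); rewrite ?a'a ?b'b.
Qed.

(** Translating a ray translates the tree ray it tends to; the image end is then forced by
    [limit_end_fun], and the image boundary point by [limit_end_inj]. *)
Lemma limit_end_orbit (xi xi' : gromov_boundary X) (omega omega' : end_space T) :
  limit_end beta xi omega -> limit_end beta xi' omega' ->
  boundary_orbit G xi xi' <-> end_orbit (act @` G) omega omega'.
Proof.
move=> R R'; have [r xir] := boundary_inhabited xi; have [tau ot] := end_inhabited omega.
have [GA _ _ _] := G_subgroup; have gr := boundary_geodesic xir; have rt := end_ray ot.
have tr := limit_end_tends X_connected T_dec T_adhesion R xir ot.
split=> [/(boundary_orbitP X_connected _ _ GA) [g [r' [Gg xir' xi'r']]]|
         /(end_orbitP T_tree _ _ act_image_automorphism) [_ [tau' [[g Gg <-] ot' o't']]]].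
  apply/(end_orbitP T_tree _ _ act_image_automorphism).
  have Gact : (act @` G) (act g) by exists g.
  exists (act g), tau; split=> //.
  have [omega'' o''] := end_class (automorphism_ray (act_automorphism Gg) rt).
  suff -> : omega' = omega'' by [].
  apply: (limit_end_fun X_connected T_dec T_adhesion R').
  exists (g \o r'), (act g \o tau); split=> //; apply: tends_act => //.
  exact: limit_end_tends R xir' ot.
apply/(boundary_orbitP X_connected _ _ GA).
exists g, r; split=> //.
have [xi'' xi''r] := boundary_class
  (automorphism_geodesic_ray X_connected (group_automorphism Gg) gr).
suff -> : xi' = xi'' by [].
apply: (limit_end_inj X_connected T_dec T_adhesion X_hyperbolic bounded_adhesion R').
exists (g \o r), (act g \o tau'); split=> //; apply: tends_act => //.
exact: limit_end_tends R xir ot'.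
Qed.

Lemma restrict_automorphism t :
  restrict_to (A := beta t) (stabilizer G act t) `<=` @automorphism (induced (beta t)).
Proof.
move=> h [g [Gg gt] hg]; have [g' [Gg' gg' g'g agg' _]] := group_inv Gg.
have /choice [h' Hh'] : forall c : induced (beta t), exists d : induced (beta t),
    incl d = g' (incl c).
  move=> c; apply: incl_surj; have := beta_act Gg' (incl_in c).
  by rewrite -{1}gt agg'.
split.
  by exists h' => c; apply: incl_inj; [rewrite Hh' hg gg'|rewrite hg Hh' g'g].
move=> a b; suff : adj (incl (h a)) (incl (h b)) = adj (incl a) (incl b) by [].
by rewrite !hg (group_automorphism Gg).2.
Qed.

Lemma boundary_map_stays g t xi eta r : G g ->
  boundary_map (g \o @incl X (beta t)) xi eta -> val xi r -> stays beta (act g t) r.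
Proof.
move=> Gg R xir; have [s etas] := boundary_inhabited eta.
have [K HK] := bag_translate_qi.
apply: (near_bag_stays X_connected T_dec T_adhesion (q := g \o @incl X (beta t) \o s)).
- exact: boundary_geodesic xir.
- by move=> j; apply: beta_act => //; exact: incl_in.
- exact: (boundary_map_fhd X_connected (@bags_connected t) (HK g t Gg) R xir etas).
Qed.

(** [stays_return] brings [r] back into the translated bag at arbitrarily late times, which is the
    input of [near_qi_ray]. *)
Lemma stays_boundary_map g t xi r : G g -> val xi r -> stays beta (act g t) r ->
  exists eta, boundary_map (g \o @incl X (beta t)) xi eta.
Proof.
move=> Gg xir st; have gr := boundary_geodesic xir; have [K HK] := bag_translate_qi.
have returns N : exists n (z : induced (beta t)), N <= n /\ dist (r n) (g (incl z)) <= 0.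
  have [n Nn tn] := stays_return X_connected T_dec N gr st.
  have [y ty ny] := beta_act_inv Gg tn; have [z zy] := incl_surj ty.
  by exists n, z; rewrite zy ny distxx.
have [n0 [z0 _]] := returns 0.
have [C HC] := near_qi_ray X_connected X_hyperbolic (@bags_connected t)
  (induced_locally_finite X_locally_finite) (HK g t Gg).
have [|s [gs _ rs]] := HC z0 r gr; first by exists 0.
have [eta etas] := boundary_class gs; exists eta, r, s; split=> //.
exact: (near_fhd X_connected (HK g t Gg) gr gs rs).
Qed.

Lemma boundary_map_orbit t g1 g2 (xi xi' : gromov_boundary X)
    (eta eta' : gromov_boundary (induced (beta t))) : G g1 -> G g2 ->
  boundary_map (g1 \o @incl X (beta t)) xi eta ->
  boundary_map (g2 \o @incl X (beta t)) xi' eta' ->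
  boundary_orbit G xi xi' <->
  boundary_orbit (restrict_to (A := beta t) (stabilizer G act t)) eta eta'.
Proof.
move=> Gg1 Gg2 R R'; have [K HK] := bag_translate_qi.
have [GA _ _ _] := G_subgroup; have t_conn := @bags_connected t.
have [h1 [Gh1 gh1 hg1 agh1 ahg1]] := group_inv Gg1.
have [h2 [Gh2 gh2 hg2 agh2 ahg2]] := group_inv Gg2.
split=> [/(boundary_orbitP X_connected _ _ GA) [g [r [Gg xir xi'gr]]]|
  /(boundary_orbitP t_conn _ _ (@restrict_automorphism t))
    [h [s [[g0 [Gg0 g0t] hg0] etas eta'hs]]]].
  have [s etas] := boundary_inhabited eta; have [s' etas'] := boundary_inhabited eta'.
  have rs := boundary_map_fhd X_connected t_conn (HK g1 t Gg1) R xir etas.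
  have grs' := boundary_map_fhd X_connected t_conn (HK g2 t Gg2) R' xi'gr etas'.
  pose g' := h2 \o (g \o g1).
  have Gg' : G g' by apply: group_comp => //; exact: group_comp.
  have ss' : finite_hausdorff_distance (g' \o (@incl X (beta t) \o s)) (@incl X (beta t) \o s').
    have /(automorphism_fhd X_connected _ _ (GA h2 Gh2)) := fhd_trans X_connected
      (fhd_sym X_connected ((automorphism_fhd X_connected _ _ (GA g Gg)).2 rs)) grs'.
    by rewrite (_ : h2 \o (g2 \o _ \o s') = @incl X (beta t) \o s') //;
      apply/funext => i /=; rewrite gh2.
  (* [g'] carries a boundary point of the bag at [t] to a boundary point of the same bag, and by
     [stays_unique] no ray belongs to two bags. *)
  have g't : act g' t = t.
    have [xi0 R0] := boundary_map_total X_connected X_locally_finite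
      X_hyperbolic (HK id t group_id) eta.
    have [r0 xi0r0] := boundary_inhabited xi0; have gr0 := boundary_geodesic xi0r0.
    have gr0' := automorphism_geodesic_ray X_connected (GA _ Gg') gr0.
    have st := boundary_map_stays group_id R0 xi0r0; rewrite act_id in st.
    apply: (stays_unique T_dec T_adhesion gr0' (stays_act Gg' st)).
    apply: (near_bag_stays X_connected T_dec T_adhesion gr0' (q := @incl X (beta t) \o s')).
      by move=> j; exact: incl_in.
    apply: fhd_trans ss' => //; apply/(automorphism_fhd X_connected _ _ (GA _ Gg')).
    exact: (boundary_map_fhd X_connected t_conn (HK id t group_id) R0 xi0r0 etas).
  have /choice [h Hh] : forall c : induced (beta t), exists d : induced (beta t),
      incl d = g' (incl c).
    by move=> c; apply: incl_surj; have := beta_act Gg' (incl_in c); rewrite g't.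
  have rh : restrict_to (stabilizer G act t) h by exists g'.
  apply/(boundary_orbitP t_conn _ _ (@restrict_automorphism t)).
  exists h, s; split=> //.
  apply: (boundary_mem t_conn etas').
    exact: automorphism_geodesic_ray (restrict_automorphism rh) (boundary_geodesic etas).
  apply: fhd_sym => //; apply: (qi_fhd_inv (HK id t group_id)).
  rewrite (_ : _ \o (h \o s) = g' \o (@incl X (beta t) \o s)) //.
  by apply/funext => i /=; rewrite Hh.
have [r xir] := boundary_inhabited xi; have [r' xi'r'] := boundary_inhabited xi'.
have rs := boundary_map_fhd X_connected t_conn (HK g1 t Gg1) R xir etas.
have r's := boundary_map_fhd X_connected t_conn (HK g2 t Gg2) R' xi'r' eta'hs.
pose g := g2 \o (g0 \o h1).
have Gg : G g by apply: group_comp => //; exact: group_comp.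
apply/(boundary_orbitP X_connected _ _ GA); exists g, r; split=> //.
apply: (boundary_mem X_connected xi'r').
  exact: automorphism_geodesic_ray (GA _ Gg) (boundary_geodesic xir).
apply: fhd_trans r's _ => //; apply: fhd_sym => //.
rewrite (_ : _ \o (h \o s) = g \o (g1 \o @incl X (beta t) \o s)).
  exact/automorphism_fhd/rs/GA.
by apply/funext => i; rewrite /= hg0 /g /= gh1.
Qed.

End GroupAction.

(** * Assembling the pieces *)

Section OrbitRepresentatives.
Variables (X T : graph) (G : set (X -> X)) (act : (X -> X) -> T -> T) (beta : T -> set X).
Hypothesis G_subgroup : aut_subgroup G.
Hypothesis T_invariant : invariant_decomposition beta G act.
Implicit Types (s t : T).

Definition same_orbit s t := `[< exists2 g, G g & act g s = t >].

Definition orbit_rep t : T := choose (same_orbit t) t.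

Lemma same_orbit_refl t : same_orbit t t.
Proof.
apply/asboolP; exists id; first exact: group_id G_subgroup.
exact: act_id T_invariant _.
Qed.

Lemma same_orbit_sym s t : same_orbit s t -> same_orbit t s.
Proof.
move=> /asboolP [g Gg <-]; apply/asboolP.
by have [h [Gh _ _ agh _]] := group_inv G_subgroup T_invariant Gg; exists h.
Qed.

Lemma same_orbit_trans s t w : same_orbit s t -> same_orbit t w -> same_orbit s w.
Proof.
move=> /asboolP [g Gg <-] /asboolP [h Gh <-]; apply/asboolP; exists (h \o g).
  exact: group_comp G_subgroup _ _ Gh Gg.
by rewrite (act_comp T_invariant).
Qed.

Lemma orbit_repP t : exists2 g, G g & act g (orbit_rep t) = t.
Proof.
by apply/asboolP/same_orbit_sym/(chooseP (P := same_orbit t))/same_orbit_refl.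
Qed.

(** [choose] sees only the extension of the predicate, and [choose_id] removes the dependence on the
    default point. *)
Lemma orbit_rep_eq s t : same_orbit s t -> orbit_rep s = orbit_rep t.
Proof.
move=> st; have E : same_orbit s =1 same_orbit t.
  move=> w; apply/idP/idP; apply: same_orbit_trans => //.
  exact: same_orbit_sym.
rewrite /orbit_rep (eq_choose E) (choose_id (P := same_orbit t) (y0 := t)) //.
- by rewrite -E same_orbit_refl.
- exact: same_orbit_refl.
Qed.

End OrbitRepresentatives.

Lemma rel_continuous_if (Y Z : topologicalType) (P : Prop) (R : Y -> Z -> Prop) :
  rel_continuous R -> rel_continuous (fun y z => P /\ R y z).
Proof. by move=> cR U /cR [W oW RW]; exists W => // y z [_ /RW]. Qed.

Lemma countable_option (T : Type) : countable [set: T] -> countable [set: option T].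
Proof.
move=> cT; apply: (sub_countable (B := [set None] `|` Some @` [set: T])).
  by apply: subset_card_le => -[t|] _; [right; exists t|left].
rewrite -bigcup2E; apply: bigcup_countable => // -[|[|n]] _ /=.
- exact: countable1.
- exact: sub_countable (card_image_le _ _) cT.
- exact: countable0.
Qed.

Section MainArguments.
Variables (X T : graph) (G : set (X -> X)) (act : (X -> X) -> T -> T) (beta : T -> set X).
Hypothesis X_connected : graph_connected X.
Hypothesis X_locally_finite : locally_finite X.
Hypothesis X_hyperbolic : hyperbolic X.
Hypothesis G_subgroup : aut_subgroup G.
Hypothesis G_countable : countable G.
Hypothesis T_dec : tree_decomposition beta.
Hypothesis T_invariant : invariant_decomposition beta G act.
Hypothesis bags_connected : forall t : T, graph_connected (induced (beta t)).
Hypothesis T_adhesion : finite_adhesion beta.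
Hypothesis finite_edge_quotient : finite_set (edge_orbits (act @` G)).

Local Notation bag_orbit t :=
  (boundary_orbit (restrict_to (A := beta t) (stabilizer G act t))).

Lemma bags_of_boundary_hyperfinite : borel_hyperfinite (boundary_orbit G) ->
  forall t, borel_hyperfinite (bag_orbit t).
Proof.
move=> hfX t; have Gid := group_id G_subgroup.
have [K HK] := bag_translate_qi X_connected G_subgroup T_dec T_invariant
  bags_connected T_adhesion finite_edge_quotient.
have qi := HK id t Gid; have t_conn := @bags_connected t.
apply: (borel_hyperfinite_pull (R := fun eta xi => boundary_map (id \o @incl X (beta t)) xi eta)
  (borel_boundary_diagonal X_connected X_locally_finite X_hyperbolic)) hfX.
- move=> eta xi xi'; exact: (boundary_map_fun X_connected t_conn qi).
- move=> xi eta eta'; exact: (boundary_map_inj X_connected t_conn qi).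
- exact: (boundary_map_inv_continuous X_connected X_locally_finite X_hyperbolic t_conn qi).
- exact: (boundary_map_total X_connected X_locally_finite X_hyperbolic qi).
- move=> eta eta' xi xi' R R'; apply: iff_sym.
  exact: (boundary_map_orbit X_connected X_locally_finite X_hyperbolic G_subgroup T_dec
    T_invariant bags_connected T_adhesion finite_edge_quotient Gid Gid R R').
Qed.

Lemma tree_of_boundary_hyperfinite : end_essential beta ->
  borel_hyperfinite (boundary_orbit G) -> borel_hyperfinite (end_orbit (act @` G)).
Proof.
move=> T_ess hfX.
have bnd := bounded_adhesion G_subgroup T_invariant bags_connected T_adhesion finite_edge_quotient.
apply: (borel_hyperfinite_pull (R := fun omega xi => limit_end beta xi omega)
  (borel_boundary_diagonal X_connected X_locally_finite X_hyperbolic)) hfX.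
- move=> omega xi xi'; exact: (limit_end_inj X_connected T_dec T_adhesion X_hyperbolic bnd).
- move=> xi omega omega'; exact: (limit_end_fun X_connected T_dec T_adhesion).
- exact: (limit_end_inv_continuous X_connected T_dec T_adhesion X_locally_finite X_hyperbolic
    bnd T_ess).
- exact: (limit_end_surj X_connected T_dec T_adhesion X_locally_finite T_ess).
- move=> omega omega' xi xi' R R'; apply: iff_sym.
  exact: (limit_end_orbit X_connected X_hyperbolic G_subgroup T_dec T_invariant
    bags_connected T_adhesion finite_edge_quotient R R').
Qed.

(* The pieces are the limit set of the tree, coded in the ends of T, and for each
   t the limit set of the bag at t, coded in the boundary of the representative
   of the orbit of t. *)
Lemma boundary_of_pieces_hyperfinite : borel_hyperfinite (end_orbit (act @` G)) ->
  (forall t, borel_hyperfinite (bag_orbit t)) -> borel_hyperfinite (boundary_orbit G).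
Proof.
move=> hfT hfB; have Gid := group_id G_subgroup.
have [GA _ _ _] := G_subgroup.
have [K HK] := bag_translate_qi X_connected G_subgroup T_dec T_invariant
  bags_connected T_adhesion finite_edge_quotient.
have bnd := bounded_adhesion G_subgroup T_invariant bags_connected T_adhesion finite_edge_quotient.
have cT := countable_tree G_subgroup T_dec T_invariant finite_edge_quotient G_countable.
have lfB t := induced_locally_finite (A := beta t) X_locally_finite.
pose rep := orbit_rep G act.
have /choice [gg Hgg] : forall t, exists g, G g /\ act g (rep t) = t.
  by move=> t; have [g Gg E] := orbit_repP G_subgroup T_invariant t; exists g.
have Ggg t : G (gg t) by have [] := Hgg t.
have ggE t : act (gg t) (rep t) = t by have [] := Hgg t.
pose Z k : topologicalType :=
  if k is Some t then gromov_boundary (induced (beta t)) else end_space T.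
pose EZ k : Z k -> Z k -> Prop :=
  match k with Some t => bag_orbit t | None => end_orbit (act @` G) end.
(* The target [k] is an orbit representative, or [None] for the ends of [T]. The index names the
   actual bag [t], reached from its representative by the fixed element [gg t]; mismatched pairs
   give the empty relation. *)
pose R k (i : option T) : gromov_boundary X -> Z k -> Prop :=
  match k with
  | Some k => fun xi eta => exists2 t, i = Some t & rep t = k /\
      boundary_map (gg t \o @incl X (beta k)) xi eta
  | None => fun xi omega => i = None /\ limit_end beta xi omega
  end.
have staysR k i xi (eta : Z (Some k)) r : R (Some k) i xi eta -> val xi r ->
    exists t, [/\ i = Some t, rep t = k & stays beta t r].
  move=> [t it [tk B]] xir; exists t; split=> //; subst k.
  rewrite -{1}(ggE t).
  exact: (boundary_map_stays X_connected G_subgroup T_dec T_invariant bags_connected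
    T_adhesion finite_edge_quotient (Ggg t) B xir).
have tendsR xi omega r : limit_end beta xi omega -> val xi r ->
    exists2 tau, ray tau & tends beta r tau.
  move=> L xir; have [tau ot] := end_inhabited omega; exists tau; first exact: end_ray ot.
  exact: (limit_end_tends X_connected T_dec T_adhesion L xir ot).
have borel_image (g : X -> X) k : G g ->
    borel (rel_dom (boundary_map (g \o @incl X (beta k)))).
  move=> Gg; rewrite -[rel_dom _]setCK; apply: borelC; apply: borel_open.
  exact: (boundary_map_image_closed X_connected X_hyperbolic (@bags_connected k) (lfB k)
    (HK g k Gg)).
apply: (@borel_hyperfinite_glue _ _ (option T) (option T) Z EZ R).
- exact: borel_boundary_diagonal.
- exact: countable_option.
- exact: countable_option.
- by case.
- move=> [k|] i xi z z' /=; last first.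
    by move=> [_ L] [_ L']; exact: (limit_end_fun X_connected T_dec T_adhesion L L').
  move=> [t -> [tk B]] [_ [<-] [_ B']].
  exact: (boundary_map_inj X_connected (@bags_connected k) (HK _ k (Ggg t)) B B').
- move=> [k|] i z xi xi' /=; last first.
    move=> [_ L] [_ L'].
    exact: (limit_end_inj X_connected T_dec T_adhesion X_hyperbolic bnd L L').
  move=> [t -> [tk B]] [_ [<-] [_ B']].
  exact: (boundary_map_fun X_connected (@bags_connected k) (HK _ k (Ggg t)) B B').
- move=> [k|] i /=; last first.
    exact/rel_continuous_if/(limit_end_continuous X_connected T_dec T_adhesion).
  case: i => [t|]; last by move=> U _; exists set0; [exact: open0|move=> y z [? ]].
  have := boundary_map_continuous X_connected X_hyperbolic (@bags_connected k) (lfB k)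
    (HK _ k (Ggg t)).
  move=> cB U /cB [W oW BW]; exists W => // xi eta [_ [<-] [_ B]]; exact: BW.
- move=> [k|] i /=; last first.
    (* By [stays_or_tends], the points with a limit end are those outside the images of all bags,
       which are countably many closed sets. *)
    rewrite (_ : rel_dom _ = [set xi | i = None /\
      (~` \bigcup_t rel_dom (boundary_map (id \o @incl X (beta t)))) xi]).
      by apply: borel_if; apply: borelC; apply: borel_bigcup => // t; exact: borel_image.
    apply/seteqP; split=> xi /=.
      move=> [omega [-> L]]; split=> // -[t _ [eta B]].
      have [r xir] := boundary_inhabited xi; have [tau rt tr] := tendsR _ _ _ L xir.
      have := boundary_map_stays X_connected G_subgroup T_dec T_invariant bags_connected
        T_adhesion finite_edge_quotient Gid B xir.
      rewrite (act_id T_invariant) => st.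
      exact: (stays_tends T_dec T_adhesion (boundary_geodesic xir) rt st tr).
    move=> [iN nB]; have [r xir] := boundary_inhabited xi.
    have [[t st]|[tau rt tr]] := stays_or_tends X_connected T_dec T_adhesion
      (boundary_geodesic xir).
      case: nB; exists t => //; apply: (stays_boundary_map X_connected X_locally_finite
        X_hyperbolic G_subgroup T_dec T_invariant bags_connected T_adhesion
        finite_edge_quotient Gid xir).
      by rewrite (act_id T_invariant).
    by have [omega ot] := end_class rt; exists omega; split=> //; exists r, tau.
  case: i => [t|]; last first.
    rewrite (_ : rel_dom _ = set0); first exact: borel0.
    by apply/seteqP; split=> // xi [eta [t]].
  rewrite (_ : rel_dom _ = [set xi | rep t = k /\
      rel_dom (boundary_map (gg t \o @incl X (beta k))) xi]).
    by apply: borel_if; exact: borel_image.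
  apply/seteqP; split=> xi /= [eta]; first by move=> [_ [<-] [tk B]]; split=> //; exists eta.
  by move=> [z B]; exists z, t.
- move=> xi; have [r xir] := boundary_inhabited xi.
  have [[t st]|[tau rt tr]] := stays_or_tends X_connected T_dec T_adhesion
      (boundary_geodesic xir).
    have [|eta B] := stays_boundary_map X_connected X_locally_finite
        X_hyperbolic G_subgroup T_dec T_invariant bags_connected T_adhesion
        finite_edge_quotient (Ggg t) (t := rep t) xir; first by rewrite ggE.
    by exists (Some (rep t)), (Some t), eta, t.
  by have [omega ot] := end_class rt; exists None, None, omega; split=> //; exists r, tau.
- move=> xi [k|] i z [k'|] i' z' Rz Rz'; have [r xir] := boundary_inhabited xi;
    have gr := boundary_geodesic xir.
  + have [t [-> <- st]] := staysR _ _ _ _ _ Rz xir.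
    have [t' [-> <- st']] := staysR _ _ _ _ _ Rz' xir.
    by rewrite (stays_unique T_dec T_adhesion gr st st').
  + have [t [_ _ st]] := staysR _ _ _ _ _ Rz xir.
    have [tau rt tr] := tendsR _ _ _ Rz'.2 xir.
    by case: (stays_tends T_dec T_adhesion gr rt st tr).
  + have [t [_ _ st]] := staysR _ _ _ _ _ Rz' xir.
    have [tau rt tr] := tendsR _ _ _ Rz.2 xir.
    by case: (stays_tends T_dec T_adhesion gr rt st tr).
  + by rewrite Rz.1 Rz'.1.
(* [g] moves the vertex at which a ray stays within its orbit, so the representative is unchanged; a
   ray that stays never tends to an end. *)
- move=> xi xi' [k|] i z [k'|] i' z' Rz Rz' /(boundary_orbitP X_connected _ _ GA)
    [g [r [Gg xir xi'gr]]]; have gr := boundary_geodesic xi'gr.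
  + have [t [_ <- st]] := staysR _ _ _ _ _ Rz xir.
    have [t' [_ <- st']] := staysR _ _ _ _ _ Rz' xi'gr.
    have := stays_act G_subgroup T_dec T_invariant Gg st.
    move=> /(stays_unique T_dec T_adhesion gr st') ->; congr Some.
    by apply: (orbit_rep_eq G_subgroup T_invariant); apply/asboolP; exists g.
  + have [t [_ _ st]] := staysR _ _ _ _ _ Rz xir.
    have [tau rt tr] := tendsR _ _ _ Rz'.2 xi'gr.
    have := stays_act G_subgroup T_dec T_invariant Gg st.
    by move=> st'; case: (stays_tends T_dec T_adhesion gr rt st' tr).
  + have [t [_ _ st]] := staysR _ _ _ _ _ Rz' xi'gr.
    have [tau rt tr] := tendsR _ _ _ Rz.2 xir.
    have tr' := tends_act T_dec T_invariant Gg tr.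
    have rt' := automorphism_ray (act_automorphism T_invariant Gg) rt.
    by case: (stays_tends T_dec T_adhesion gr rt' st tr').
  + by [].
- move=> xi xi' [k|] i z j w /=; last first.
    move=> [_ L] [_ L'].
    exact: (limit_end_orbit X_connected X_hyperbolic G_subgroup T_dec T_invariant
      bags_connected T_adhesion finite_edge_quotient L L').
  move=> [t _ [tk B]] [t' _ [tk' B']].
  exact: (boundary_map_orbit X_connected X_locally_finite X_hyperbolic G_subgroup T_dec
    T_invariant bags_connected T_adhesion finite_edge_quotient (Ggg t) (Ggg t') B B').
Qed.

End MainArguments.

Theorem theorem5p5 (X T : graph) (G : set (X -> X))
    (act : (X -> X) -> T -> T) (beta : T -> set X)
    (X_connected : graph_connected X)
    (X_locally_finite : locally_finite X)
    (X_hyperbolic : hyperbolic X)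
    (G_subgroup : aut_subgroup G)
    (G_countable : countable G)
    (T_decomposition : tree_decomposition beta)
    (T_invariant : invariant_decomposition beta G act)
    (bags_connected : forall t : T, graph_connected (induced (beta t)))
    (T_finite_adhesion : finite_adhesion beta)
    (finite_edge_quotient : finite_set (edge_orbits (act @` G))) :
  let E_X := borel_hyperfinite (boundary_orbit G) in
  let E_T := borel_hyperfinite (end_orbit (act @` G)) in
  let E_bag (t : T) := borel_hyperfinite
    (boundary_orbit (restrict_to (A := beta t) (stabilizer G act t))) in
  [/\ E_T -> (forall t : T, E_bag t) -> E_X,
      E_X -> forall t : T, E_bag t
    & end_essential beta -> (E_X <-> E_T /\ forall t : T, E_bag t)].
Proof.
move=> E_X E_T E_bag.
have bags : E_X -> forall t, E_bag t by exact: bags_of_boundary_hyperfinite.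
have glue : E_T -> (forall t, E_bag t) -> E_X by exact: boundary_of_pieces_hyperfinite.
split=> // essential; split=> [hfX|[]]; last exact: glue.
split; last exact: bags.
apply: (tree_of_boundary_hyperfinite (beta := beta)) hfX => //.
Qed.
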